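(* In an edge-to-edge dihedral tiling of a flat torus by unit-area tiles, each congruent either to one fixed efficient pentagon or to one fixed Type 2 non-convex pentagon, if the ratio of the number of efficient pentagons to the number of non-convex pentagons exceeds $24$, then the tiling has at least one degree-four efficient vertex.
   Context: Edge-to-edge means adjacent tiles meet only along entire edges or at vertices. A dihedral tiling is one with two prototiles. A unit-area pentagon is efficient if its perimeter is less than or equal to that of a unit-area Cairo pentagon, namely $2\sqrt{2+\sqrt3}\approx 3.86$. (A Cairo pentagon has three angles of $2\pi/3$ and two nonadjacent right angles and is circumscribed about a circle.) A Type 2 non-convex pentagon is a pentagon with two interior angles (adjacent or non-adjacent) larger than $\pi$. An efficient vertex is a vertex of the tiling which is surrounded exclusively by efficient pentagons; its degree is the number of tiles (equivalently edges) meeting there. *)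

(* Defs.v *)
(* The plane is R * R for an abstract R : realType of MathComp-Analysis. *)
From HB Require Import structures.
From mathcomp Require Import all_boot all_order all_algebra.
From mathcomp Require Import all_classical all_reals all_analysis.

Set Implicit Arguments.
Unset Strict Implicit.
Unset Printing Implicit Defensive.

Import Order.TTheory GRing.Theory Num.Theory.
Import numFieldNormedType.Exports.

Local Open Scope classical_set_scope.
Local Open Scope ring_scope.

(* The norm that MathComp-Analysis puts on R * R is the max norm, so the
   Euclidean metric is spelled out. *)
Definition dot (R : realType) (u w : R * R) : R := u.1 * w.1 + u.2 * w.2.

Definition cross (R : realType) (u w : R * R) : R := u.1 * w.2 - u.2 * w.1.

Definition enorm (R : realType) (u : R * R) : R := Num.sqrt (dot u u).

Definition segment (R : realType) (p q : R * R) : set (R * R) :=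
  [set x | exists2 t : R, 0 <= t <= 1 & x = p + t *: (q - p)].

(* The five vertices in cyclic order; [ordS i] and [ord_pred i] are the cyclic
   successor and predecessor of i. *)
Definition polygon5 (R : realType) : Type := 'I_5 -> R * R.

Definition edge (R : realType) (P : polygon5 R) (i : 'I_5) : set (R * R) :=
  segment (P i) (P (ordS i)).

Definition boundary (R : realType) (P : polygon5 R) : set (R * R) :=
  \bigcup_(i in [set: 'I_5]) edge P i.

Definition simple_pentagon (R : realType) (P : polygon5 R) : Prop :=
  injective P /\
  forall (i j : 'I_5) (x : R * R), i != j -> edge P i x -> edge P j x ->
    (j = ordS i /\ x = P j) \/ (i = ordS j /\ x = P i).

(* The closed region enclosed by the boundary (Jordan curve theorem): the
   boundary and the bounded components of its complement. *)
Definition region (R : realType) (P : polygon5 R) : set (R * R) :=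
  boundary P `|`
  [set x | (~` boundary P) x /\
           bounded_set (connected_component (~` boundary P) x)].

Definition area (R : realType) (P : polygon5 R) : \bar R :=
  ((@lebesgue_measure R) \x (@lebesgue_measure R))%E (region P).

Definition perimeter (R : realType) (P : polygon5 R) : R :=
  \sum_(i < 5) enorm (P (ordS i) - P i).

(* Twice the signed area (shoelace formula): positive iff the vertices of a
   simple pentagon are listed counterclockwise. *)
Definition shoelace (R : realType) (P : polygon5 R) : R :=
  \sum_(i < 5) cross (P i) (P (ordS i)).

(* Interior angle at P i, in [0, 2 pi): the unoriented angle of the two edges
   at P i if the boundary turns there in the direction in which it goes around
   the region (or goes straight on), and its complement to 2 pi otherwise. *)
Definition angle (R : realType) (P : polygon5 R) (i : 'I_5) : R :=
  let u := P (ordS i) - P i in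
  let w := P (ord_pred i) - P i in
  let a := acos (dot u w / (enorm u * enorm w)) in
  if 0 <= shoelace P * cross u w then a else 2 * pi - a.

(* 2 sqrt (2 + sqrt 3) is the perimeter of the unit-area Cairo pentagon. *)
Definition efficient (R : realType) (P : polygon5 R) : Prop :=
  [/\ simple_pentagon P, area P = 1%:E &
      perimeter P <= 2 * Num.sqrt (2 + Num.sqrt 3)].

Definition type2_nonconvex (R : realType) (P : polygon5 R) : Prop :=
  simple_pentagon P /\ #|[set i : 'I_5 | pi < angle P i]%SET| = 2%N.

Definition isometry (R : realType) (f : R * R -> R * R) : Prop :=
  forall x y : R * R, enorm (f x - f y) = enorm (x - y).

(* Isometries may reverse orientation, so mirror images are congruent. *)
Definition congruent (R : realType) (P Q : polygon5 R) : Prop :=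
  exists2 f : R * R -> R * R, isometry f & forall i : 'I_5, Q i = f (P i).

(* [T] indexes the tiles of the torus; the tile t is represented by one of its
   lifts to the plane, and its other lifts are the translates of that one by
   a *~ lat1 + b *~ lat2. *)
Definition translate (R : realType) (T : finType) (lat1 lat2 : R * R)
    (tile : T -> polygon5 R) (k : T * int * int) : polygon5 R :=
  fun i => tile k.1.1 i + lat1 *~ k.1.2 + lat2 *~ k.2.

(* A tiling, by pentagons, of the flat torus R^2 / (Z lat1 + Z lat2), given as
   the corresponding periodic tiling of the plane. *)
Record torus_tiling (R : realType) (T : finType) := TorusTiling {
  lat1 : R * R;
  lat2 : R * R;
  tile : T -> polygon5 R;
  lattice_rank2 : cross lat1 lat2 != 0;
  tile_simple : forall t : T, simple_pentagon (tile t);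
  tiling_cover : forall x : R * R,
    exists k : T * int * int, region (translate lat1 lat2 tile k) x;
  tiling_disjoint : forall k l : T * int * int, k <> l ->
    (region (translate lat1 lat2 tile k))° `&` (region (translate lat1 lat2 tile l))°
      = set0
}.

Definition lifted_tile (R : realType) (T : finType) (D : torus_tiling R T)
    (k : T * int * int) : polygon5 R :=
  translate (lat1 D) (lat2 D) (tile D) k.

(* Two tiles may share several edges (e.g. both edges at a reflex vertex), so
   their intersection is only required to be a union of common edges and common
   vertices. *)
Definition edge_to_edge (R : realType) (T : finType) (D : torus_tiling R T) :
    Prop :=
  forall (k l : T * int * int) (x : R * R), k <> l ->
    region (lifted_tile D k) x -> region (lifted_tile D l) x ->
    (exists i j : 'I_5, x = lifted_tile D k i /\ x = lifted_tile D l j) \/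
    (exists i j : 'I_5, edge (lifted_tile D k) i x /\
                        edge (lifted_tile D k) i = edge (lifted_tile D l) j).

Definition is_vertex (R : realType) (T : finType) (D : torus_tiling R T)
    (x : R * R) : Prop :=
  exists (k : T * int * int) (i : 'I_5), x = lifted_tile D k i.

(* Tiles are counted in the plane: a tile of the torus with several corners at
   a vertex counts once for each of them. *)
Definition tiles_at (R : realType) (T : finType) (D : torus_tiling R T)
    (x : R * R) : set (T * int * int) :=
  [set k | region (lifted_tile D k) x].

Definition has_degree (R : realType) (T : finType) (D : torus_tiling R T)
    (x : R * R) (d : nat) : Prop :=
  (tiles_at D x #= `I_d)%card.

Definition copies (R : realType) (T : finType) (D : torus_tiling R T)
    (P : polygon5 R) : {set T} :=
  [set t | `[< congruent P (tile D t) >]]%SET.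

(* Main.v *)
(* A unit-area pentagon with a vertex in the convex hull of the other four has
   perimeter at least 4, so an efficient pentagon is strictly convex. Cutting off
   the triangle at a corner of angle at most 2 pi / 5 and bounding the remaining
   quadrilateral by Bretschneider's inequality shows that all its angles exceed
   2 pi / 5, so at most four efficient corners fit around a vertex. If no
   efficient vertex has degree four, all of them have degree at most three, so
   the excess (angle - 2 pi / 3), summed over the efficient corners at efficient
   vertices, is nonnegative. Over all n_E efficient tiles it sums to
   - n_E pi / 3, and at most 20 n_N efficient corners, each contributing at least
   - 4 pi / 15, lie at the other vertices. Hence n_E <= 16 n_N. *)
Require Import Defs.
From mathcomp Require Import all_boot all_order all_algebra.
From mathcomp Require Import all_classical all_reals all_analysis.
From mathcomp Require Import measurable_realfun.
From mathcomp Require Import ring lra.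
Set Implicit Arguments.
Unset Strict Implicit.
Unset Printing Implicit Defensive.
Import Order.TTheory GRing.Theory Num.Theory.
Import numFieldNormedType.Exports.
Local Open Scope classical_set_scope.
Local Open Scope ring_scope.

(** * The numerical inequality behind the angle bound *)

(** The obstacle is that [region] is defined by bounded components of a complement, not by
    coordinates. Two facts replace the Jordan curve theorem: the region lies in every convex set
    that contains the vertices, and for a strictly convex pentagon it contains the intersection of
    the open half-planes of its edges. Since the area is prescribed to be 1, only upper bounds on
    areas have to be proved. Angles around a point are lengths of sets of directions in [0, 2 pi).
    Disjoint interiors give disjoint open cones, hence a sum of at most 2 pi; the covering property
    and local finiteness give closed cones that cover, hence a sum of at least 2 pi. The same two
    estimates, applied to exterior cones, yield the angle sum 3 pi of a convex pentagon. Congruent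
    copies are handled through distances between vertices alone, which determine convex position and
    the cosines of the corners. *)

Lemma amgm_weighted (R : realFieldType) (l x X Y : R) : 0 < l -> 0 <= X -> 0 <= Y ->
  x ^+ 2 <= X * Y -> 2 * x <= l * X + l^-1 * Y.
Proof.
move=> l0 X0 Y0 hx.
have li0 : 0 < l^-1 by rewrite invr_gt0.
have S0 : 0 <= l * X + l^-1 * Y by rewrite addr_ge0 // mulr_ge0 // ltW.
rewrite leNgt; apply/negP => lt.
have : (l * X + l^-1 * Y) ^+ 2 < (2 * x) ^+ 2.
  by rewrite ltr_pXn2r // ?nnegrE //; apply: ltW; apply: le_lt_trans lt.
have -> : (l * X + l^-1 * Y) ^+ 2 = (l * X - l^-1 * Y) ^+ 2 + 4 * (X * Y).
  by field; rewrite lt0r_neq0.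
have := sqr_ge0 (l * X - l^-1 * Y); lra.
Qed.

(* Here s, w, tau and kap are as in tri_quad_area_lt4 and q is the largest
   possible p. The left side bounds 2 (tau + kap): the first summands are a convex
   combination of the two bounds on 2 tau, the last one is a weighted AM-GM bound
   on 2 kap. The weights depend on the range of s. *)
Lemma quad_poly_small (R : realFieldType) (s w : R) (q := 483 / 125 - s) (Y := (q + 3 * w) / 3) :
  0 <= w -> w <= s -> s <= 197 / 100 ->
  (3 / 2) * (73 / 100 * (s ^+ 2 - w ^+ 2)) +
  (1 / 4) * (8 / 5 * w ^+ 2 + 5 / 8 * (s ^+ 2 - w ^+ 2)) +
  (6 / 5 * ((q - w) * Y) + 5 / 6 * Y ^+ 2) < 8.
Proof.
rewrite /Y /q => w0 ws s2.
have [s3|s3] := lerP s (13 / 10).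
  have h1 : 0 <= (s - w) * (13 / 10 - s) by apply: mulr_ge0; lra.
  have h2 : 0 <= (s - w) * (13 / 10 - w) by apply: mulr_ge0; lra.
  (* For these [s] the left side increases in [w] up to [w = s]; on that line it is a concave
     quadratic in [s] with its maximum near 86/100. *)
  have h3 := sqr_ge0 (s - 86 / 100); lra.
have h1 : 0 <= (s - 13 / 10) * (197 / 100 - s) by apply: mulr_ge0; lra.
(* For fixed [s] the left side is concave in [w]; the square is centred at its maximizer, about
   0.557 times 483/125 - s. *)
have h2 := sqr_ge0 (w - (215 / 100 - 557 / 1000 * s)).
have h3 : 0 <= w * (s - 13 / 10) by apply: mulr_ge0; lra.
have h4 : 0 <= w * (197 / 100 - s) by apply: mulr_ge0; lra.
lra.
Qed.

Lemma quad_poly_mid (R : realFieldType) (s w : R) (q := 483 / 125 - s) (Y := (q + 3 * w) / 3) :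
  0 <= w -> w <= s -> 197 / 100 <= s -> s <= 5 / 2 ->
  (1 / 2) * (73 / 100 * (s ^+ 2 - w ^+ 2)) +
  (3 / 4) * (7 / 5 * w ^+ 2 + 5 / 7 * (s ^+ 2 - w ^+ 2)) +
  (9 / 5 * ((q - w) * Y) + 5 / 9 * Y ^+ 2) < 8.
Proof.
rewrite /Y /q => w0 ws s1 s2.
have h1 : 0 <= (s - 197 / 100) * (5 / 2 - s) by apply: mulr_ge0; lra.
(* Again the maximizer in [w], now about 0.717 times 483/125 - s. *)
have h2 := sqr_ge0 (w - (277 / 100 - 717 / 1000 * s)).
have h3 : 0 <= w * (s - 197 / 100) by apply: mulr_ge0; lra.
have h4 : 0 <= w * (5 / 2 - s) by apply: mulr_ge0; lra.
lra.
Qed.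

Lemma quad_poly_large (R : realFieldType) (s w : R) (q := 483 / 125 - s) (Y := (q + 3 * w) / 3) :
  0 <= w -> w <= q -> 5 / 2 <= s ->
  (2 * w ^+ 2 + 1 / 2 * (s ^+ 2 - w ^+ 2)) +
  (2 * ((q - w) * Y) + 1 / 2 * Y ^+ 2) < 8.
Proof.
rewrite /Y /q => w0 ws s2.
have h1 : 0 <= w * (483 / 125 - s - w) by apply: mulr_ge0; lra.
have h2 : 0 <= w * (s - 5 / 2) by apply: mulr_ge0; lra.
have h3 : 0 <= (s - 5 / 2) * (483 / 125 - s - w) by apply: mulr_ge0; lra.
lra.
Qed.

(* A pentagon is cut into the triangle at one corner, with area tau / 4, legs of
   total length s and base w, and a quadrilateral of area kap / 4 whose other
   three sides have total length p. The constant 73 / 100 exceeds tan (pi / 5)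
   and 483 / 125 exceeds the perimeter 2 sqrt (2 + sqrt 3). *)
Lemma tri_quad_area_lt4 (R : realFieldType) (s p w tau kap : R) :
  0 <= w -> w <= s -> w <= p -> s + p <= 483 / 125 ->
  tau <= 73 / 100 * (s ^+ 2 - w ^+ 2) -> tau ^+ 2 <= w ^+ 2 * (s ^+ 2 - w ^+ 2) ->
  27 * kap ^+ 2 <= (p - w) * (p + 3 * w) ^+ 3 ->
  tau + kap < 4.
Proof.
have [P1 P2 P3] : [/\ 0 < 8 / 5 :> R, 0 < 6 / 5 :> R & 0 < 7 / 5 :> R] by split; lra.
have [P4 P5] : 0 < 9 / 5 :> R /\ 0 < 2 :> R by split; lra.
move=> w0 ws wp sp htau htau2 hkap.
have s0 : 0 <= s by lra.
have D0 : 0 <= s ^+ 2 - w ^+ 2 by rewrite subr_ge0 ler_pXn2r // nnegrE.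
have tA (l : R) : 0 < l -> 2 * tau <= l * w ^+ 2 + l^-1 * (s ^+ 2 - w ^+ 2).
  by move=> l0; apply: amgm_weighted => //; exact: sqr_ge0.
(* The bound on [kap] grows with [p], so [p] is replaced by the largest value that the perimeter
   allows. *)
have [q [qp sq]] : exists q, p <= q /\ s + q = 483 / 125.
  by exists (483 / 125 - s); split;lra.
set Y := (q + 3 * w) / 3.
have kA (l : R) : 0 < l -> 2 * kap <= l * ((q - w) * Y) + l^-1 * Y ^+ 2.
  move=> l0; have Y0 : 0 <= Y by rewrite /Y;lra.
  apply: amgm_weighted => //; [apply: mulr_ge0 => //; lra | exact: sqr_ge0 |].
  have -> : (q - w) * Y * Y ^+ 2 = ((q - w) * (q + 3 * w) ^+ 3) / 27 by rewrite /Y; field.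
  rewrite ler_pdivlMr //.
  rewrite mulrC; apply: le_trans hkap _; apply: ler_pM => //; try lra.
    by apply: exprn_ge0;lra.
  by rewrite ler_pXn2r // ?nnegrE;lra.
have {}sq : q = 483 / 125 - s by lra.
move: kA tA; rewrite {}/Y (_ : q = 483 / 125 - s); last by rewrite -sq; ring.
move=> kA tA; clear qp sq hkap D0 htau2.
have sc (a : R) : w <= s -> 0 <= a -> a * tau <= a * (73 / 100 * (s ^+ 2 - w ^+ 2)).
  by move=> _ a0; rewrite ler_wpM2l.
(* In the convex combination bounding [tau], the weight of the angle bound [htau] drops from 3/4 to
   1/4 to 0 as [s] grows. *)
have [s1|s1] := lerP s (197 / 100).
  have := quad_poly_small w0 ws s1; have := tA _ P1; have := kA _ P2.
  rewrite !invf_div; clear -htau; lra.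
have [s2|s2] := lerP s (5 / 2).
  have := quad_poly_mid w0 ws (ltW s1) s2; have := tA _ P3; have := kA _ P4.
  rewrite !invf_div; clear -htau; lra.
have wq : w <= 483 / 125 - s by lra.
have := quad_poly_large w0 wq (ltW s2); have := tA _ P5; have := kA _ P5.
clear -sp; lra.
Qed.

(** * Area bounds by vertical sections *)

Lemma coordE (R : realType) :
  ((forall u v : R * R, ((u + v).1 = u.1 + v.1)%R) *
   (forall u v : R * R, ((u + v).2 = u.2 + v.2)%R) *
   (forall u : R * R, ((- u).1 = - u.1)%R) * (forall u : R * R, ((- u).2 = - u.2)%R) *
   (forall (a : R) (u : R * R), ((a *: u).1 = a * u.1)%R) *
   (forall (a : R) (u : R * R), ((a *: u).2 = a * u.2)%R))%type.
Proof. by []. Qed.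

Lemma eq_coord (R : realType) (u v : R * R) : u.1 = v.1 -> u.2 = v.2 -> u = v.
Proof. by case: u v => [? ?] [? ?] /= -> ->. Qed.

Section SectionArea.
Variable R : realType.
Local Notation mu := (@lebesgue_measure R).

Lemma ge0_le_integralT (f g : R -> \bar R) :
  (forall x, 0 <= f x)%E -> (forall x, f x <= g x)%E ->
  (\int[mu]_x f x <= \int[mu]_x g x)%E.
Proof.
move=> f0 fg; have g0 x : (0 <= g x)%E by apply: le_trans (fg x).
rewrite !ge0_integralTE //; apply: le_ereal_sup => _ [h hf <-].
by exists h => // x; apply: le_trans (fg x).
Qed.

Lemma le_lebesgue_measure (A B : set R) : A `<=` B -> (mu A <= mu B)%E.
Proof. by move=> AB; rewrite /lebesgue_measure /lebesgue_stieltjes_measure /measure_extension; apply: le_outer_measure. Qed.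

Lemma lebesgue_measureU_le (A B : set R) : (mu (A `|` B) <= mu A + mu B)%E.
Proof.
rewrite /lebesgue_measure /lebesgue_stieltjes_measure /measure_extension.
exact: outer_measureU2.
Qed.

(* An upper bound on area by a bound on the vertical sections. S need not be
   measurable: both the Lebesgue measure, being an outer measure, and the
   integral of nonnegative functions are monotone without measurability. *)
Definition area_le (S : set (R * R)) (v : R) : Prop :=
  exists g : R -> R, [/\ forall x, 0 <= g x, measurable_fun setT g,
    forall x, (mu (xsection S x) <= (g x)%:E)%E & (\int[mu]_x (g x)%:E <= v%:E)%E].

Lemma area_le_product S v : area_le S v -> ((mu \x mu) S <= v%:E)%E.
Proof.
move=> [g [g0 mg Sg gv]]; rewrite /product_measure1; apply: le_trans gv.
by apply: ge0_le_integralT => // x; exact: measure_ge0.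
Qed.

Lemma area_le_sub S S' v v' : S `<=` S' -> v' <= v -> area_le S' v' -> area_le S v.
Proof.
move=> SS' vv' [g [g0 mg Sg gv]]; exists g; split => // [x|].
  by apply: le_trans (Sg x); apply: le_lebesgue_measure; exact: le_xsection.
by apply: le_trans gv _; rewrite lee_fin.
Qed.

Lemma area_leU S S' v v' : area_le S v -> area_le S' v' -> area_le (S `|` S') (v + v').
Proof.
move=> [g [g0 mg Sg gv]] [g' [g0' mg' Sg' gv']]; exists (g \+ g'); split => [x||x|].
- by rewrite addr_ge0.
- exact: measurable_funD.
- apply: (@le_trans _ _ (mu (xsection S x `|` xsection S' x))).
    by apply: le_lebesgue_measure => y; rewrite !xsectionE.
  apply: le_trans (lebesgue_measureU_le _ _) _.
  by rewrite EFinD leeD.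
- under eq_integral do rewrite EFinD.
  rewrite ge0_integralD //=; [by rewrite EFinD leeD| | | |] => //.
  + by move=> x _; rewrite lee_fin.
  + exact/measurable_EFinP.
  + by move=> x _; rewrite lee_fin.
  + exact/measurable_EFinP.
Qed.

(** Only one vertical section is nonempty. Its length has to be bounded because the dominating
    function of [area_le] is real-valued. *)
Lemma area_le_vline (S : set (R * R)) (a m M : R) :
  (forall p, S p -> p.1 = a /\ m <= p.2 <= M) -> area_le S 0.
Proof.
move=> hS; exists (fun x => (`|M - m|) * \1_([set a] : set R) x); split.
- by move=> x; rewrite mulr_ge0.
- apply: measurable_funM => //; exact: measurable_indic.
- move=> x; rewrite indicE; case: (pselect (x = a)) => [->|xa].
    rewrite mem_set // mulr1.
    apply: (@le_trans _ _ (mu `[m, M]%classic)).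
      apply: le_lebesgue_measure => y; rewrite /xsection /= inE => /hS [_ /=].
      by rewrite in_itv.
    rewrite lebesgue_measure_itv /=; case: ifP => _; last by rewrite lee_fin.
    by rewrite -EFinB lee_fin ler_norm.
  rewrite (_ : xsection S x = set0) ?measure0 ?lee_fin ?mulr_ge0 //.
  by rewrite -subset0 => y; rewrite /xsection /= inE => /hS [/=].
- under eq_integral do rewrite EFinM.
  rewrite ge0_integralZl //=.
  + by rewrite integral_indic //= setIT lebesgue_measure_set1 mule0.
  + exact/measurable_EFinP/measurable_indic.
Qed.

Lemma integral_linear (k a m M : R) : m <= M ->
  (\int[mu]_(x in `[m, M]) (k * (x - a))%:E = (k / 2 * ((M - a) ^+ 2 - (m - a) ^+ 2))%:E)%E.
Proof.
rewrite le_eqVlt => /orP[/eqP<-|mM].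
  by rewrite subrr mulr0 set_itv1 integral_set1.
have dF (x : R) : is_derive x 1 (fun x => k / 2 * (x - a) ^+ 2) (k * (x - a)).
  by apply: is_derive_eq; rewrite /GRing.scale /=; field.
have cX : continuous (fun x : R => x - a).
  by move=> x; apply: cvgB; [exact: cvg_id | exact: cvg_cst].
have cF : continuous (fun x : R => k / 2 * (x - a) ^+ 2).
  by move=> x; apply: cvgM; [exact: cvg_cst | apply: cvgM; exact: cX].
have := @continuous_FTC2 R (fun x => k * (x - a)) (fun x => k / 2 * (x - a) ^+ 2) m M mM.
move=> -> //.
- by rewrite -EFinB mulrBr.
- by apply: continuous_subspaceT => x; apply: cvgM; [exact: cvg_cst | exact: cX].
- split; first by move=> x _; apply: ex_derive.
  + by apply: cvg_at_right_filter; exact: cF.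
  + by apply: cvg_at_left_filter; exact: cF.
- by move=> x _; rewrite derive1E derive_val.
Qed.

Definition triangle (p q r : R * R) : set (R * R) :=
  [set x | exists a b c : R, [/\ 0 <= a, 0 <= b, 0 <= c, a + b + c = 1 &
     x = a *: p + b *: q + c *: r]].

(** Each vertical section is contained in a copy of the vertical side, scaled by the ratio of the
    horizontal distances from the apex [p]; the scaled lengths integrate to half of base times
    height. *)
Lemma area_le_triangle_vert (p q r : R * R) : q.1 = r.1 -> p.1 != q.1 ->
  area_le (triangle p q r) (`|q.1 - p.1| * `|r.2 - q.2| / 2).
Proof.
case: p q r => [px py] [qx qy] [rx ry] /= <- {rx} pq.
set m := Num.min px qx; set M := Num.max px qx.
have mM : m <= M by rewrite /m /M ge_min !le_max !lexx.
have qp0 : qx - px != 0 by rewrite subr_eq0 eq_sym.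
pose k := `|ry - qy| / (qx - px).
pose g x := k * (x - px) * \1_(`[m, M]%classic : set R) x.
have t0 x : x \in `[m, M]%classic -> 0 <= (x - px) / (qx - px).
  rewrite inE /= in_itv /= /m /M ge_min le_max.
  case: (ltgtP px qx) pq => // lt _.
  - by move=> /andP[/orP[h|h] _]; rewrite divr_ge0 // subr_ge0 ?(ltW lt) //; lra.
  - move=> /andP[_ /orP[h|h]]; rewrite -mulrNN -invrN divr_ge0 //; lra.
have kE x : k * (x - px) = `|ry - qy| * ((x - px) / (qx - px)).
  by rewrite /k mulrAC mulrA.
have mg : measurable_fun setT g.
  apply: measurable_funM; last exact: measurable_indic.
  apply: measurable_funM => //; exact: measurable_funB.
exists g; split => //.
- move=> x; rewrite /g indicE; case: (boolP (x \in _)) => [h|_]; last by rewrite mulr0.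
  by rewrite mulr1 kE mulr_ge0 // t0.
- move=> x; rewrite /g indicE; case: (boolP (x \in _)) => [h|h].
    rewrite mulr1 kE; set t := (x - px) / _.
    have t_ge0 : 0 <= t by exact: t0.
    pose lo := (1 - t) * py + t * Num.min qy ry.
    pose hi := (1 - t) * py + t * Num.max qy ry.
    apply: (@le_trans _ _ (mu `[lo, hi]%classic)).
      apply: le_lebesgue_measure => y; rewrite xsectionE /= => -[a [b [c [a0 b0 c0 abc]]]].
      move=> [xE yE]; rewrite in_itv /=.
      have tE : t = b + c.
        apply: (mulIf qp0); rewrite /t divfK // xE /GRing.scale /=.
        by rewrite (_ : a = 1 - b - c); [ring | rewrite -abc; ring].
      have -> : y = (1 - t) * py + (b * qy + c * ry).
        by rewrite yE /GRing.scale /= tE (_ : a = 1 - b - c); [ring | rewrite -abc; ring].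
      rewrite /lo /hi !lerD2l tE !mulrDl !lerD // ler_wpM2l // ?ge_min ?le_max lexx ?orbT //.
    rewrite lebesgue_measure_itv /=; case: ifP => _; last by rewrite lee_fin mulr_ge0.
    rewrite -EFinB lee_fin /hi /lo.
    rewrite (_ : _ - _ = (Num.max qy ry - Num.min qy ry) * t); last by ring.
    by apply: ler_wpM2r => //; case: (lerP qy ry) => _; rewrite ?ler_norm // distrC ler_norm.
  rewrite mulr0 (_ : xsection _ x = set0) ?measure0 //.
  rewrite -subset0 => y; rewrite xsectionE /= => -[a [b [c [a0 b0 c0 abc]]]] [xE _].
  case/negP: h; rewrite inE /= in_itv /= xE /GRing.scale /= /m /M ge_min le_max.
  have aE : a = 1 - b - c by rewrite -abc; ring.
  have -> : a * px + b * qx + c * qx = qx - a * (qx - px) by rewrite aE; ring.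
  case: (lerP px qx) => lt.
    have h1 : 0 <= a * (qx - px) by apply: mulr_ge0 => //; lra.
    have h2 : 0 <= (b + c) * (qx - px) by apply: mulr_ge0; lra.
    have h3 : (b + c) * (qx - px) = qx - px - a * (qx - px) by rewrite aE; ring.
    by apply/andP; split; apply/orP; [left | right]; lra.
  have h1 : 0 <= a * (px - qx) by apply: mulr_ge0 => //; lra.
  have h2 : 0 <= (b + c) * (px - qx) by apply: mulr_ge0; lra.
  have h3 : (b + c) * (px - qx) = px - qx - a * (px - qx) by rewrite aE; ring.
  by apply/andP; split; apply/orP; [right | left]; lra.
- have -> : (fun x => (g x)%:E) = ((fun x => (k * (x - px))%:E) \_ `[m, M]).
    by apply/funext => x; rewrite /g /patch indicE; case: ifPn => h; rewrite ?(negbTE h) ?h ?mulr1 ?mulr0.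
  rewrite -integral_mkcond integral_linear // lee_fin /k /m /M.
  case: (ltgtP px qx) pq => // lt _.
    rewrite subrr expr0n /= subr0 (_ : `|qx - px| = qx - px); last by rewrite gtr0_norm // subr_gt0.
    rewrite le_eqVlt; apply/orP; left; apply/eqP; field.
    by rewrite subr_eq0 gt_eqF.
  rewrite subrr expr0n /= sub0r (_ : `|qx - px| = px - qx); last by rewrite ltr0_norm ?opprB // subr_lt0.
  rewrite le_eqVlt; apply/orP; left; apply/eqP; field.
  by rewrite subr_eq0 lt_eqF.
Qed.

Lemma triangle_swapl p q r : triangle p q r `<=` triangle q p r.
Proof.
move=> x [a [b [c [a0 b0 c0 abc ->]]]]; exists b, a, c; split => //.
  by rewrite (addrC b).
by rewrite (addrC (b *: q)).
Qed.

Lemma triangle_swapr p q r : triangle p q r `<=` triangle p r q.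
Proof.
move=> x [a [b [c [a0 b0 c0 abc ->]]]]; exists a, c, b; split => //.
  by rewrite addrAC.
by rewrite addrAC.
Qed.

Lemma area_le_triangle_vline (p q r : R * R) : q.1 = p.1 -> r.1 = p.1 ->
  area_le (triangle p q r) 0.
Proof.
case: p q r => [px py] [qx qy] [rx ry] /= -> ->.
apply: (@area_le_vline _ px (- (`|py| + `|qy| + `|ry|)) (`|py| + `|qy| + `|ry|)).
move=> x [a [b [c [a0 b0 c0 abc ->]]]] /=; rewrite /GRing.scale /=; split.
  by rewrite -!mulrDl abc mul1r.
rewrite -ler_norml; apply: le_trans (ler_normD _ _) _.
rewrite lerD //; last by rewrite normrM ger0_norm // ler_piMl //; lra.
apply: le_trans (ler_normD _ _) _.
by rewrite !normrM (ger0_norm a0) (ger0_norm b0) lerD // ler_piMl //; lra.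
Qed.

Lemma triangle_split (p q r m : R * R) (t : R) : 0 <= t <= 1 -> m = (1 - t) *: p + t *: r ->
  triangle p q r `<=` triangle p q m `|` triangle r q m.
Proof.
move=> /andP[t0 t1] mE x [a [b [c [a0 b0 c0 abc xE]]]].
have ineq : 0 <= (a * t - (1 - t) * c) \/ 0 <= ((1 - t) * c - a * t).
  by case: (lerP 0 (a * t - (1 - t) * c)); [left | right; lra].
rewrite {}mE {}xE.
case: ineq => h.
- have [t00|tn0] := eqVneq t 0.
    left; exists a, b, c; split => //.
    move: h; rewrite t00 mulr0 subr0 mul1r sub0r => h.
    have -> : c = 0 by lra.
    by apply: eq_coord; rewrite !coordE; ring.
  left; exists ((a * t - (1 - t) * c) / t), b, (c / t); split => //.
  + by rewrite divr_ge0.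
  + by rewrite divr_ge0.
  + by rewrite -[RHS]abc; field.
  + by apply: eq_coord; rewrite !coordE; field.
- have [t11|tn1] := eqVneq t 1.
    right; exists c, b, a; split => //.
    + by rewrite -[RHS]abc; ring.
    + move: h; rewrite t11 subrr mul0r mulr1 sub0r => h.
      have -> : a = 0 by lra.
      by apply: eq_coord; rewrite !coordE; ring.
  have tn1' : 1 - t != 0 by rewrite subr_eq0 eq_sym.
  have t1' : 0 <= 1 - t by lra.
  right; exists (((1 - t) * c - a * t) / (1 - t)), b, (a / (1 - t)); split => //.
  + by rewrite divr_ge0.
  + by rewrite divr_ge0.
  + by rewrite -[RHS]abc; field.
  + by apply: eq_coord; rewrite !coordE; field.
Qed.

(** The vertical line through the middle vertex [q] meets the opposite side in [m] and cuts the
    triangle into two triangles with the vertical side [q m]. *)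
Lemma area_le_triangle_sorted (p q r : R * R) : p.1 <= q.1 -> q.1 <= r.1 ->
  area_le (triangle p q r) (`|cross (q - p) (r - p)| / 2).
Proof.
move=> pq qr.
have vert (u v w : R * R) : v.1 = w.1 ->
    area_le (triangle u v w) (`|v.1 - u.1| * `|w.2 - v.2| / 2).
  move=> vw; have [uv|uv] := eqVneq u.1 v.1; last exact: area_le_triangle_vert.
  rewrite uv subrr normr0 mul0r mul0r.
  by apply: area_le_triangle_vline; rewrite -?vw uv.
have [pr|pr] := eqVneq p.1 r.1.
  have qp : q.1 = p.1 by apply/eqP; rewrite eq_le pq pr qr.
  apply: (area_le_sub (S' := triangle p q r) (v' := 0)) => //.
  exact: area_le_triangle_vline.
have lt : p.1 < r.1 by rewrite lt_neqAle pr (le_trans pq).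
have d0 : 0 < r.1 - p.1 by rewrite subr_gt0.
pose t := (q.1 - p.1) / (r.1 - p.1); pose m := (1 - t) *: p + t *: r.
have t01 : 0 <= t <= 1.
  by rewrite /t divr_ge0 ?ler_pdivrMr ?mul1r ?subr_ge0 ?(ltW d0) //= ?lerD2r ?subr_ge0 // ltW.
have mE : q.1 = m.1.
  rewrite /m /t !coordE; field; exact: lt0r_neq0.
have := area_leU (vert p q m mE) (vert r q m mE).
apply: area_le_sub; first exact: (triangle_split t01).
rewrite (distrC q.1 r.1) (ger0_norm (x := r.1 - q.1)) ?subr_ge0 // ger0_norm ?subr_ge0 //.
rewrite -mulrDl -mulrDl (_ : q.1 - p.1 + (r.1 - q.1) = r.1 - p.1); last by ring.
rewrite -(ger0_norm (ltW d0)) -normrM.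
rewrite le_eqVlt; apply/orP; left; apply/eqP; congr (_ / _).
rewrite /cross; congr (`| _ |); rewrite /m /t !coordE; field; exact: lt0r_neq0.
Qed.

Lemma area_le_triangle (p q r : R * R) :
  area_le (triangle p q r) (`|cross (q - p) (r - p)| / 2).
Proof.
have swl (u v w : R * R) : area_le (triangle v u w) (`|cross (u - v) (w - v)| / 2) ->
    area_le (triangle u v w) (`|cross (v - u) (w - u)| / 2).
  apply: area_le_sub; first exact: triangle_swapl.
  rewrite -normrN le_eqVlt; apply/orP; left; apply/eqP; congr (`| _ | / 2).
  by rewrite /cross !coordE; ring.
have swr (u v w : R * R) : area_le (triangle u w v) (`|cross (w - u) (v - u)| / 2) ->
    area_le (triangle u v w) (`|cross (v - u) (w - u)| / 2).
  apply: area_le_sub; first exact: triangle_swapr.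
  rewrite -normrN le_eqVlt; apply/orP; left; apply/eqP; congr (`| _ | / 2).
  by rewrite /cross !coordE; ring.
have [pq|/ltW pq] := lerP p.1 q.1; have [qr|/ltW qr] := lerP q.1 r.1;
  have [pr|/ltW pr] := lerP p.1 r.1.
- exact: area_le_triangle_sorted.
- exact: area_le_triangle_sorted.
- by apply: (swr); apply: area_le_triangle_sorted.
- by apply: (swr); apply: (swl); apply: area_le_triangle_sorted.
- by apply: (swl); apply: area_le_triangle_sorted.
- by apply: (swl); apply: (swr); apply: area_le_triangle_sorted.
- by apply: (swr); apply: (swl); apply: (swr); apply: area_le_triangle_sorted.
- by apply: (swr); apply: (swl); apply: (swr); apply: area_le_triangle_sorted.
Qed.

End SectionArea.

(** * Plane vectors and convex hulls *)

Section Vectors.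
Variable R : realType.
Implicit Types u v w : R * R.

Lemma dot_ge0 u : 0 <= dot u u.
Proof. by rewrite /dot -!expr2 addr_ge0 ?sqr_ge0. Qed.

Lemma enorm_ge0 u : 0 <= enorm u.
Proof. exact: sqrtr_ge0. Qed.

Lemma sqr_enorm u : enorm u ^+ 2 = dot u u.
Proof. by rewrite sqr_sqrtr // dot_ge0. Qed.

Lemma dotC u v : dot u v = dot v u.
Proof. by rewrite /dot; ring. Qed.

Lemma enormN u : enorm (- u) = enorm u.
Proof. by rewrite /enorm /dot !coordE; congr Num.sqrt; ring. Qed.

Lemma enorm_distC u v : enorm (u - v) = enorm (v - u).
Proof. by rewrite -enormN opprB. Qed.

Lemma enorm_eq0 u : (enorm u == 0) = (u == 0).
Proof.
apply/idP/idP => [|/eqP ->]; last by rewrite /enorm /dot /= !mulr0 addr0 sqrtr0.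
rewrite sqrtr_eq0 => h; apply/eqP; have : dot u u = 0 by apply/eqP; rewrite eq_le h dot_ge0.
rewrite /dot -!expr2 => /eqP; rewrite paddr_eq0 ?sqr_ge0 // !sqrf_eq0 => /andP[/eqP h1 /eqP h2].
by apply: eq_coord.
Qed.

Lemma enorm_gt0 u : u != 0 -> 0 < enorm u.
Proof. by move=> u0; rewrite lt_neqAle eq_sym enorm_eq0 u0 enorm_ge0. Qed.

Lemma lagrange_dot_cross u v : dot u v ^+ 2 + cross u v ^+ 2 = (enorm u * enorm v) ^+ 2.
Proof. by rewrite exprMn !sqr_enorm /dot /cross; ring. Qed.

Lemma cross_eq0 (u v : R * R) : u != 0 -> cross u v = 0 -> v = (dot u v / dot u u) *: u.
Proof.
move=> u0 c0; have d0 : dot u u != 0 by rewrite -sqr_enorm sqrf_eq0 enorm_eq0.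
apply: (scalerI d0); rewrite scalerA mulrC divfK //.
move: c0; rewrite /cross /dot => c0.
by apply: eq_coord; rewrite !coordE; apply/eqP; rewrite -subr_eq0; apply/eqP;
  [transitivity (- u.2 * (u.1 * v.2 - u.2 * v.1)) | transitivity (u.1 * (u.1 * v.2 - u.2 * v.1))];
  by [ring | rewrite c0 mulr0].
Qed.

Lemma ler_norm_cross u v : `|cross u v| <= enorm u * enorm v.
Proof.
rewrite -(ler_pXn2r (n := 2)) ?nnegrE ?mulr_ge0 ?enorm_ge0 //.
by rewrite -lagrange_dot_cross real_normK ?num_real // lerDr sqr_ge0.
Qed.

Lemma ler_norm_dot u v : `|dot u v| <= enorm u * enorm v.
Proof.
rewrite -(ler_pXn2r (n := 2)) ?nnegrE ?mulr_ge0 ?enorm_ge0 //.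
by rewrite -lagrange_dot_cross real_normK ?num_real // lerDl sqr_ge0.
Qed.

Lemma ler_enormD u v : enorm (u + v) <= enorm u + enorm v.
Proof.
rewrite -(ler_pXn2r (n := 2)) ?nnegrE ?addr_ge0 ?enorm_ge0 //.
have := ler_norm_dot u v; have := ler_norm (dot u v).
have -> : enorm (u + v) ^+ 2 = enorm u ^+ 2 + enorm v ^+ 2 + 2 * dot u v.
  by rewrite !sqr_enorm /dot !coordE; ring.
by move=> h1 h2; rewrite sqrrD; lra.
Qed.

Lemma ler_enorm_dist v u w : enorm (w - u) <= enorm (v - u) + enorm (w - v).
Proof. by rewrite (_ : w - u = (v - u) + (w - v)) ?ler_enormD //; apply: eq_coord; rewrite !coordE; ring. Qed.

End Vectors.

Section Hull.
Variable R : realType.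
Implicit Types p q r : R * R.

Definition hull (I : finType) (Q : I -> R * R) : set (R * R) :=
  [set x | exists l : I -> R, [/\ forall i, 0 <= l i, \sum_i l i = 1 &
     x = \sum_i l i *: Q i]].

(** The hull of the points other than [Q j]. Keeping weights on all of [I], with a zero at [j],
    gives all these faces the same index type. *)
Definition subhull (I : finType) (Q : I -> R * R) (j : I) : set (R * R) :=
  [set x | exists l : I -> R, [/\ forall i, 0 <= l i, l j = 0, \sum_i l i = 1 &
     x = \sum_i l i *: Q i]].

(* Caratheodory step: subtract from the weights the largest multiple of an
   affine dependence k that keeps them nonnegative. *)
Lemma hull_sub_faces (I : finType) (Q : I -> R * R) (k : I -> R) (j : I) :
  \sum_i k i = 0 -> \sum_i k i *: Q i = 0 -> 0 < k j ->
  forall x, hull Q x -> exists2 i, 0 < k i & subhull Q i x.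
Proof.
move=> k0 kQ kj x [l [l0 l1 ->]].
case: (arg_minP (fun i => l i / k i) (P := fun i => 0 < k i) kj) => i ki imin.
exists i => //; exists (fun m => l m - l i / k i * k m); split => [m|||].
- have t0 : 0 <= l i / k i by rewrite divr_ge0 // ltW.
  have [km|km] := ltrP 0 (k m); first by rewrite subr_ge0 -ler_pdivlMr // imin.
  by rewrite subr_ge0 (le_trans _ (l0 m)) // mulr_ge0_le0.
- by rewrite divfK ?subrr // gt_eqF.
- by rewrite big_split /= l1 sumrN -mulr_sumr k0 mulr0 subr0.
- under [RHS]eq_bigr do rewrite scalerBl -scalerA.
  by rewrite big_split /= sumrN -scaler_sumr kQ scaler0 subr0.
Qed.

Lemma area_le_bigU (I : eqType) (s : seq I) (T : I -> set (R * R)) (v : I -> R) :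
  (forall i, area_le (T i) (v i)) ->
  area_le [set x | exists2 i, i \in s & T i x] (\sum_(i <- s) v i).
Proof.
move=> hT; elim: s => [|i s IH].
  rewrite big_nil; apply: (@area_le_vline _ _ 0 0 0) => p [i].
  by rewrite in_nil.
rewrite big_cons; apply: (area_le_sub _ (lexx _) (area_leU (hT i) IH)) => x [j].
by rewrite in_cons => /orP[/eqP -> ?|? ?]; [left | right; exists j].
Qed.

(** The faces with [k i > 0] cover the hull, and by the dependence [- k] so do those with [k i < 0].
    The cheaper of the two covers costs at most half of the total. For a convex quadrilateral these
    are the triangulations by its two diagonals. *)
Lemma area_le_hull (I : finType) (Q : I -> R * R) (k : I -> R) (v : I -> R) :
  \sum_i k i = 0 -> \sum_i k i *: Q i = 0 -> (exists j, k j != 0) ->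
  (forall i, 0 <= v i) -> (forall i, area_le (subhull Q i) (v i)) ->
  area_le (hull Q) ((\sum_i v i) / 2).
Proof.
move=> k0 kQ [j kj] v0 hv.
have half (h : I -> R) : \sum_i h i = 0 -> \sum_i h i *: Q i = 0 -> (exists j, h j != 0) ->
    area_le (hull Q) (\sum_(i | 0 < h i) v i).
  move=> h0 hQ [m hm].
  have [m' hm'] : exists m', 0 < h m'.
    case: (boolP [exists i, 0 < h i]) => [/existsP //|/existsPn hn].
    have le0 i : 0 <= - h i by rewrite oppr_ge0 leNgt hn.
    have : \sum_i - h i == 0 by rewrite sumrN h0 oppr0.
    rewrite psumr_eq0 // => /allP /(_ m (mem_index_enum _)) /=.
    by rewrite oppr_eq0 (negbTE hm).
  rewrite -big_filter.
  apply: (area_le_sub _ (lexx _) (area_le_bigU _ hv)) => x hx.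
  have [i hi Tx] := hull_sub_faces h0 hQ hm' hx.
  by exists i => //; rewrite mem_filter hi mem_index_enum.
have pos := half k k0 kQ (ex_intro _ j kj).
have neg := half (fun i => - k i).
have {}neg : area_le (hull Q) (\sum_(i | k i < 0) v i).
  under eq_bigl do rewrite -oppr_gt0.
  apply: neg; first by rewrite sumrN k0 oppr0.
    by under eq_bigr do rewrite scaleNr; rewrite sumrN kQ oppr0.
  by exists j; rewrite oppr_eq0.
have le : (\sum_(i | 0 < k i) v i) + (\sum_(i | k i < 0) v i) <= \sum_i v i.
  rewrite (bigID (fun i => 0 < k i) predT) /= lerD2l.
  rewrite big_mkcond [leRHS]big_mkcond; apply: ler_sum => i _.
  by case: (ltgtP (k i) 0) => // _; exact: v0.
have [h|h] := lerP (\sum_(i | 0 < k i) v i) ((\sum_i v i) / 2).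
  exact: (area_le_sub _ h pos).
by apply: (area_le_sub _ _ neg) => //; lra.
Qed.

Definition quad (q0 q1 q2 q3 : R * R) (i : 'I_4) : R * R :=
  [:: q0; q1; q2; q3]`_i.

Lemma sum_quad (q0 q1 q2 q3 : R * R) (l : 'I_4 -> R) :
  \sum_i l i *: quad q0 q1 q2 q3 i =
  l 0 *: q0 + l 1 *: q1 + l 2%:R *: q2 + l 3%:R *: q3.
Proof.
rewrite !big_ord_recl big_ord0 addr0 !addrA /quad /=.
by do !congr (_ + l _ *: _); apply: val_inj.
Qed.

Lemma sum_ord4 (l : 'I_4 -> R) : \sum_i l i = l 0 + l 1 + l 2%:R + l 3%:R.
Proof.
rewrite !big_ord_recl big_ord0 addr0 !addrA.
by do !congr (_ + l _); apply: val_inj.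
Qed.

Lemma affine_dependence (q0 q1 q2 q3 : R * R) : q0 != q1 ->
  exists k : 'I_4 -> R, [/\ \sum_i k i = 0, \sum_i k i *: quad q0 q1 q2 q3 i = 0 &
    exists j, k j != 0].
Proof.
move=> q01.
suff [a [b [c [d [sum0 lin0 nz]]]]] : exists a b c d : R,
    [/\ a + b + c + d = 0, a *: q0 + b *: q1 + c *: q2 + d *: q3 = 0 & (c != 0) || (d != 0)].
  exists (fun i : 'I_4 => [:: a; b; c; d]`_i); split.
  - by rewrite !big_ord_recl big_ord0 addr0 !addrA.
  - by rewrite sum_quad.
  - by case/orP: nz => nz; [exists 2%:R | exists 3%:R].
have [c0|c0] := eqVneq (cross (q1 - q0) (q2 - q0)) 0.
  have q10 : q1 - q0 != 0 by rewrite subr_eq0 eq_sym.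
  have := cross_eq0 q10 c0; set r := _ / _ => q2E.
  exists (1 - r), r, (-1), 0; split; [by ring| |by rewrite oppr_eq0 oner_eq0].
  rewrite scale0r addr0 scaleN1r -[q2](subrK q0) q2E.
  by apply: eq_coord; rewrite !coordE /=; ring.
(* Signed areas: [g - al - be], [al] and [be] are [g] times the barycentric coordinates of [q3] in
   the triangle [q0 q1 q2]. *)
pose al := cross (q3 - q0) (q2 - q0); pose be := cross (q1 - q0) (q3 - q0).
pose g := cross (q1 - q0) (q2 - q0).
exists (g - al - be), al, be, (- g); split; [by ring| |by rewrite oppr_eq0 c0 orbT].
by apply: eq_coord; rewrite /g /al /be /cross !coordE /=; ring.
Qed.

(** A triangle on three consecutive points has area at most half the product of its two sides in the
    cycle. Half the sum of these four bounds factors into the two sums of opposite sides. *)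
Lemma area_le_quad_hull (q0 q1 q2 q3 : R * R) : q0 != q1 ->
  area_le (hull (quad q0 q1 q2 q3))
    ((enorm (q1 - q0) + enorm (q3 - q2)) * (enorm (q2 - q1) + enorm (q0 - q3)) / 4).
Proof.
move=> q01; have [k [k0 kQ knz]] := affine_dependence q2 q3 q01.
pose e (u v : R * R) := enorm (v - u).
have tri (p q r : R * R) : area_le (triangle p q r) (e p q * e q r / 2).
  apply: (area_le_sub _ _ (area_le_triangle p q r)) => //.
  rewrite ler_pM2r //.
  rewrite (_ : cross _ _ = cross (q - p) (r - q)); first exact: ler_norm_cross.
  by rewrite /cross !coordE; ring.
pose v (i : 'I_4) : R := [:: e q1 q2 * e q2 q3 / 2; e q2 q3 * e q3 q0 / 2;
   e q3 q0 * e q0 q1 / 2; e q0 q1 * e q1 q2 / 2]`_i.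
have := @area_le_hull _ _ k v k0 kQ knz.
have -> : (\sum_i v i) / 2 = (e q0 q1 + e q2 q3) * (e q1 q2 + e q3 q0) / 4.
  by rewrite !big_ord_recl big_ord0 /v /=; field.
apply.
  by case=> [[|[|[|[|]]]]] //= ?; rewrite /v /= divr_ge0 // mulr_ge0 // enorm_ge0.
have face (a b c d : 'I_4) (p q r : R * R) :
    (forall l : 'I_4 -> R, \sum_i l i = l a + l b + l c + l d) ->
    (forall l : 'I_4 -> R, l a = 0 ->
      \sum_i l i *: quad q0 q1 q2 q3 i = l b *: p + l c *: q + l d *: r) ->
    subhull (quad q0 q1 q2 q3) a `<=` triangle p q r.
  move=> sumE linE x [l [l0 la l1 ->]]; rewrite linE //.
  by exists (l b), (l c), (l d); split; rewrite // -l1 sumE la add0r.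
case=> [[|[|[|[|]]]]] //= hi; rewrite /v /=.
- apply: (area_le_sub _ (lexx _) (tri q1 q2 q3)); apply: (face _ 1 2%:R 3%:R) => l.
    by rewrite sum_ord4; congr (l _ + _ + _ + _); apply: val_inj.
  by rewrite (_ : Ordinal hi = 0) ?sum_quad => [->|]; [rewrite scale0r add0r | apply: val_inj].
- apply: (area_le_sub _ (lexx _) (tri q2 q3 q0)); apply: (face _ 2%:R 3%:R 0) => l.
    rewrite sum_ord4 (_ : Ordinal hi = 1); [ring | exact: val_inj].
  rewrite (_ : Ordinal hi = 1) ?sum_quad => [->|]; last exact: val_inj.
  by apply: eq_coord; rewrite !coordE; ring.
- apply: (area_le_sub _ (lexx _) (tri q3 q0 q1)); apply: (face _ 3%:R 0 1) => l.
    rewrite sum_ord4 (_ : Ordinal hi = 2%:R); [ring | exact: val_inj].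
  rewrite (_ : Ordinal hi = 2%:R) ?sum_quad => [->|]; last exact: val_inj.
  by apply: eq_coord; rewrite !coordE; ring.
- apply: (area_le_sub _ (lexx _) (tri q0 q1 q2)); apply: (face _ 0 1 2%:R) => l.
    rewrite sum_ord4 (_ : Ordinal hi = 3%:R); [ring | exact: val_inj].
  rewrite (_ : Ordinal hi = 3%:R) ?sum_quad => [->|]; last exact: val_inj.
  by apply: eq_coord; rewrite !coordE; ring.
Qed.
End Hull.

(** * The region enclosed by a pentagon *)

Section Region.
Variable R : realType.
Implicit Types (P : polygon5 R) (x y p q : R * R).

Lemma segment_left p q : segment p q p.
Proof. by exists 0; rewrite ?lexx ?ler01 // scale0r addr0. Qed.

Lemma segment_right p q : segment p q q.
Proof. by exists 1; rewrite ?lexx ?ler01 // scale1r addrC subrK. Qed.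

Lemma line_continuous p q : continuous (fun t : R => p + t *: q).
Proof. by move=> t; apply: cvgD; [exact: cvg_cst | apply: cvgZr_tmp; exact: cvg_id]. Qed.

Lemma segmentE p q : segment p q = (fun t : R => p + t *: (q - p)) @` `[0, 1].
Proof.
by apply/seteqP; split=> x [t] /=; rewrite ?in_itv /= => t01 e; exists t => //=; rewrite ?in_itv.
Qed.

Lemma connected_segment p q : connected (segment p q).
Proof.
rewrite segmentE; apply: connected_continuous_connected; first exact: segment_connected.
exact/continuous_subspaceT/line_continuous.
Qed.

Lemma closed_segment p q : closed (segment p q).
Proof.
apply: compact_closed; first exact: norm_hausdorff.
rewrite segmentE; apply: continuous_compact; last exact: segment_compact.
exact/continuous_subspaceT/line_continuous.
Qed.

Lemma closed_boundary P : closed (boundary P).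
Proof.
by apply: closed_bigcup => [|i _]; [exact: finite_finset | exact: closed_segment].
Qed.

Lemma connected_ray p q : connected ((fun t : R => p + t *: q) @` `[0, +oo[).
Proof.
apply: connected_continuous_connected; last exact/continuous_subspaceT/line_continuous.
apply/connected_intervalP => x y; rewrite /= !in_itv /= !andbT => x0 _ z /andP[xz _].
by rewrite in_itv /= andbT (le_trans x0).
Qed.

Lemma unbounded_ray p q : q != 0 -> ~ bounded_set ((fun t : R => p + t *: q) @` `[0, +oo[).
Proof.
move=> q0 [M [_ hM]].
have n0 : 0 < `|q| by rewrite normr_gt0.
pose t := (`|M| + 1 + `|p| + 1) / `|q|.
have t0 : 0 <= t by rewrite divr_ge0 // !addr_ge0.
have ltM : M < `|M| + 1 by rewrite (le_lt_trans (ler_norm _)) // ltrDl.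
have /(_ _) := hM _ ltM (p + t *: q).
have img : ((fun t : R => p + t *: q) @` `[0, +oo[) (p + t *: q).
  by exists t => //=; rewrite in_itv /= t0.
move=> /(_ img); apply/negP; rewrite -ltNge.
have : `|t *: q| <= `|p + t *: q| + `|p|.
  by rewrite -{1}(addKr p (t *: q)) addrC (le_trans (ler_normB _ _)).
rewrite normrZ (ger0_norm t0) divfK ?gt_eqF //.
by move: `|p| `|p + _| => a b h; lra.
Qed.

Lemma bounded_set_sub (A B : set (R * R)) : A `<=` B -> bounded_set B -> bounded_set A.
Proof.
by move=> AB [M [Mr hM]]; exists M; split => // N MN x /AB; exact: hM.
Qed.

(* From a point outside a convex set, at least one of two opposite rays misses
   the set; that ray then makes the component unbounded. *)
Lemma region_sub_convex P (H : set (R * R)) :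
  (forall x y, H x -> H y -> segment x y `<=` H) -> (forall i, H (P i)) ->
  region P `<=` H.
Proof.
move=> cH HP x [[i _]|[nbx bx]]; first exact: cH.
have bH : boundary P `<=` H by move=> y [i _]; exact: cH.
apply: contrapT => nHx.
suff ray (e : R * R) : e != 0 -> (forall t, 0 <= t -> ~ H (x + t *: e)) -> False.
  pose e : R * R := (1, 0).
  have e0 : e != 0 by rewrite xpair_eqE oner_eq0.
  case: (pselect (forall t, 0 <= t -> ~ H (x + t *: e))) => [|/existsNP[s /not_implyP[s0 /contrapT Hs]]].
    exact: ray.
  apply: (ray (- e)); first by rewrite oppr_eq0.
  move=> t t0 Ht; apply: nHx; apply: (cH _ _ Hs Ht).
  have [st|st] := eqVneq (s + t) 0.
    have s00 : s = 0 by lra.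
    by rewrite s00 scale0r addr0; exact: segment_left.
  have stp : 0 < s + t by rewrite lt_neqAle eq_sym st addr_ge0.
  exists (s / (s + t)); first by rewrite divr_ge0 ?addr_ge0 //= ler_pdivrMr // mul1r lerDl.
  by apply: eq_coord; rewrite !coordE; field.
move=> e0 he; apply: (unbounded_ray (p := x) e0); apply: bounded_set_sub bx.
apply: connected_component_max.
- by exists 0 => /=; rewrite ?scale0r ?addr0 // in_itv /= lexx.
- by move=> y [t /=]; rewrite in_itv /= andbT => t0 <- /bH; exact: he.
- exact: connected_ray.
Qed.

(** A ball that misses the boundary lies in a single component of the complement, so it cannot meet
    the region without its centre belonging to it. *)
Lemma closed_region P : closed (region P).
Proof.
rewrite -openC openE => x nx.
have nb : (~` boundary P) x by move=> h; apply: nx; left.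
have ob : open (~` boundary P) by rewrite openC; exact: closed_boundary.
have /nbhs_ballP [e /= e0 hball] : nbhs x (~` boundary P) by exact: open_nbhs_nbhs.
apply/nbhs_ballP; exists e => // y xy [|[_ yb]]; first exact: hball.
apply: nx; right; split => //; rewrite (@same_connected_component _ _ _ y) //.
apply: (@connected_component_max _ _ (segment x y)); [exact: segment_left| |exact: connected_segment|exact: segment_right].
move=> z [t /andP[t0 t1] ->]; apply: hball.
move: xy; rewrite -!ball_normE /= opprD addrA subrr add0r normrN normrZ => xy.
by rewrite (le_lt_trans _ xy) // ger0_norm // distrC ler_piMl.
Qed.

End Region.

Lemma ordS5K (i : 'I_5) : ordS (ordS (ordS (ordS (ordS i)))) = i.
Proof. by case: i => [[|[|[|[|[|]]]]] //= ?]; apply: val_inj. Qed.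

Lemma ord_pred5E (i : 'I_5) : ord_pred i = ordS (ordS (ordS (ordS i))).
Proof. by case: i => [[|[|[|[|[|]]]]] //= ?]; apply: val_inj. Qed.

Lemma ord5_split (i j : 'I_5) :
  j \in [:: i; ordS i; ordS (ordS i); ordS (ordS (ordS i)); ordS (ordS (ordS (ordS i)))].
Proof. by case: i => [[|[|[|[|[|]]]]] //= ?]; case: j => [[|[|[|[|[|]]]]] //= ?]. Qed.

Lemma ordS5_neq (i : 'I_5) :
  [/\ ordS i != i, ordS (ordS i) != i, ordS (ordS (ordS i)) != i &
      ordS (ordS (ordS (ordS i))) != i].
Proof. by case: i => [[|[|[|[|[|]]]]] //= ?]. Qed.

Lemma ordS5_inj : injective (@ordS 5).
Proof. by move=> i j /(congr1 (@ordS 5 \o @ordS 5 \o @ordS 5 \o @ordS 5)) /=; rewrite !ordS5K. Qed.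

(** * Strictly convex pentagons as intersections of half-planes *)

Section ConvexPentagon.
Variable R : realType.
Implicit Types (P : polygon5 R) (x y p q r : R * R) (s : R).

(** The sign of [s] is the orientation: with the right one, [side] is nonnegative on the inner side
    of the line through edge [i], whichever way the vertices are listed. *)
Definition side P s (i : 'I_5) x := s * cross (P (ordS i) - P i) (x - P i).

Definition strictly_convex P s :=
  forall i j : 'I_5, j != i -> j != ordS i -> 0 < side P s i (P j).

Lemma side_ordS P s i : side P s i (P (ordS i)) = 0.
Proof. by rewrite /side /cross; ring. Qed.

Lemma side_id P s i : side P s i (P i) = 0.
Proof. by rewrite /side /cross !coordE; ring. Qed.

Lemma side_ge0 P s i j : strictly_convex P s -> 0 <= side P s i (P j).
Proof.
move=> cP; have [->|ji] := eqVneq j i; first by rewrite side_id.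
have [->|jSi] := eqVneq j (ordS i); first by rewrite side_ordS.
exact/ltW/cP.
Qed.

Lemma strictly_convex_turn P s i : strictly_convex P s ->
  0 < s * cross (P (ordS i) - P i) (P (ordS (ordS i)) - P (ordS i)).
Proof.
move=> cP; have [h1 h2 _ _] := ordS5_neq i.
have := cP i (ordS (ordS i)) h2; rewrite (inj_eq ordS5_inj) h1 => /(_ isT).
by congr (_ < _); rewrite /side /cross !coordE; ring.
Qed.

Lemma side_segment P s i x y z : 0 <= side P s i x -> 0 <= side P s i y -> segment x y z -> 0 <= side P s i z.
Proof.
move=> hx hy [t /andP[t0 t1] ->].
have -> : side P s i (x + t *: (y - x)) = (1 - t) * side P s i x + t * side P s i y.
  by rewrite /side /cross !coordE; ring.
by rewrite addr_ge0 // mulr_ge0 // subr_ge0.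
Qed.

Lemma region_side P s i x : strictly_convex P s -> region P x -> 0 <= side P s i x.
Proof.
move=> cP; apply: (region_sub_convex (H := [set x | 0 <= side P s i x])) => [y z|j] /=.
  by move=> hy hz w; apply: side_segment.
exact: side_ge0.
Qed.

(** On the line of edge [i], the half-planes of the two neighbouring edges cut out exactly the
    parameters between 0 and 1. *)
Lemma side_boundary P s i x : strictly_convex P s -> (forall j, 0 <= side P s j x) ->
  side P s i x = 0 -> edge P i x.
Proof.
move=> cP hx h0.
have turn := strictly_convex_turn i cP.
have turn' := strictly_convex_turn (ordS (ordS (ordS (ordS i)))) cP.
rewrite ordS5K in turn'.
have s0 : s != 0 by apply: contraTneq turn => ->; rewrite mul0r ltxx.
set e := P (ordS i) - P i in turn turn' *.
have e0 : e != 0 by apply: contraTneq turn => ->; rewrite /cross /= !mul0r subr0 mulr0 ltxx.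
have c0 : cross e (x - P i) = 0 by apply: (mulfI s0); rewrite mulr0.
have xE := cross_eq0 e0 c0; move: xE; set t := _ / _ => xE.
have {}xE : x = P i + t *: e by rewrite -xE addrC subrK.
exists t => //; apply/andP; split.
  have := hx (ordS (ordS (ordS (ordS i)))); rewrite /side ordS5K xE.
  set w := P i - _ in turn' *.
  have -> : s * cross w (P i + t *: e - P (ordS (ordS (ordS (ordS i))))) = t * (s * cross w e).
    by rewrite /w /cross !coordE; ring.
  by rewrite pmulr_lge0.
have := hx (ordS i); rewrite /side xE.
set w := P (ordS (ordS i)) - _ in turn *.
have -> : s * cross w (P i + t *: e - P (ordS i)) = (1 - t) * (s * cross e w).
  by rewrite /w /e /cross !coordE; ring.
by rewrite pmulr_lge0 // subr_ge0.
Qed.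

Lemma triangle_side p q r x s : 0 < s * cross (q - p) (r - p) ->
  0 <= s * cross (q - p) (x - p) -> 0 <= s * cross (r - q) (x - q) ->
  0 <= s * cross (p - r) (x - r) -> triangle p q r x.
Proof.
move=> D0 h1 h2 h3.
have s0 : s != 0 by apply: contraTneq D0 => ->; rewrite mul0r ltxx.
set D := cross (q - p) (r - p) in D0.
have c0 : D != 0 by apply: contraTneq D0 => ->; rewrite mulr0 ltxx.
have scal c : 0 <= s * c -> 0 <= c / D.
  by move=> hc; rewrite (_ : c / D = s * c / (s * D)) ?divr_ge0 ?(ltW D0) //; field; rewrite c0.
move: (scal _ h1) (scal _ h2) (scal _ h3).
have sumE : cross (r - q) (x - q) + cross (p - r) (x - r) + cross (q - p) (x - p) = D.
  by rewrite /D /cross !coordE; ring.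
have E1 : D * x.1 = cross (r - q) (x - q) * p.1 + cross (p - r) (x - r) * q.1 + cross (q - p) (x - p) * r.1.
  by rewrite /D /cross !coordE; ring.
have E2 : D * x.2 = cross (r - q) (x - q) * p.2 + cross (p - r) (x - r) * q.2 + cross (q - p) (x - p) * r.2.
  by rewrite /D /cross !coordE; ring.
move: sumE E1 E2; move: (cross (r - q) _) (cross (p - r) _) (cross (q - p) (x - p)) => a b c sumE E1 E2 c1 a1 b1.
exists (a / D), (b / D), (c / D); split => //; first by rewrite -!mulrDl sumE divff.
by apply: eq_coord; rewrite !coordE; apply: (mulfI c0); rewrite ?E1 ?E2; field.
Qed.

(** The two diagonals from [P i] fan the pentagon into three triangles, and the position of [x]
    relative to these diagonals selects one. This serves both boundedness and the area bound. *)
Lemma side_fan P s i x : strictly_convex P s -> (forall j, 0 <= side P s j x) ->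
  let v := P i in let a := P (ordS i) in let b := P (ordS (ordS i)) in
  let c := P (ordS (ordS (ordS i))) in let d := P (ordS (ordS (ordS (ordS i)))) in
  (triangle v a b `|` triangle v b c `|` triangle v c d) x.
Proof.
move=> cP hx v a b c d.
have [n1 n2 n3 n4] := ordS5_neq i.
have pos k j : j != k -> j != ordS k -> 0 < s * cross (P (ordS k) - P k) (P j - P k) by exact: cP.
have h0 := hx i; have h1 := hx (ordS i); have h2 := hx (ordS (ordS i)).
have h3 := hx (ordS (ordS (ordS i))); have h4 := hx (ordS (ordS (ordS (ordS i)))).
move: h0 h1 h2 h3 h4; rewrite /side ordS5K -/v -/a -/b -/c -/d => h0 h1 h2 h3 h4.
have t1 : 0 < s * cross (a - v) (b - v) by apply: pos; rewrite ?(inj_eq ordS5_inj).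
have t2 : 0 < s * cross (b - v) (c - v).
  have -> : cross (b - v) (c - v) = cross (c - b) (v - b) by rewrite /cross !coordE; ring.
  by apply: (pos (ordS (ordS i))); rewrite eq_sym.
have t3 : 0 < s * cross (c - v) (d - v).
  have -> : cross (c - v) (d - v) = cross (d - c) (v - c) by rewrite /cross !coordE; ring.
  by apply: (pos (ordS (ordS (ordS i)))); rewrite eq_sym.
have [g1|/ltW g1] := lerP (s * cross (b - v) (x - v)) 0.
  left; left; apply: (triangle_side t1) => //.
  have -> : cross (v - b) (x - b) = - cross (b - v) (x - v) by rewrite /cross !coordE; ring.
  by rewrite mulrN oppr_ge0.
have [g2|/ltW g2] := lerP (s * cross (c - v) (x - v)) 0.
  left; right; apply: (triangle_side t2) => //.
  have -> : cross (v - c) (x - c) = - cross (c - v) (x - v) by rewrite /cross !coordE; ring.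
  by rewrite mulrN oppr_ge0.
by right; apply: (triangle_side t3).
Qed.

Lemma side_continuous P s i : continuous (side P s i).
Proof.
have -> : side P s i = fun y => s * ((P (ordS i) - P i).1 * (y.2 - (P i).2)
    - (P (ordS i) - P i).2 * (y.1 - (P i).1)) by [].
move=> x; apply: cvgM; first exact: cvg_cst.
apply: cvgB; apply: cvgM; try exact: cvg_cst.
  by apply: cvgB; [exact: cvg_snd | exact: cvg_cst].
by apply: cvgB; [exact: cvg_fst | exact: cvg_cst].
Qed.

Lemma open_side_gt0 P s : open [set x | forall i, 0 < side P s i x].
Proof.
rewrite openE => x hx.
apply: (@filter_forall _ _ (fun i => [set y | 0 < side P s i y]) (nbhs x)) => i.
have : open (side P s i @^-1` [set y | 0 < y]).
  by apply: open_comp; [move=> y _; exact: side_continuous | exact: open_gt].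
by rewrite openE => /(_ x (hx i)).
Qed.

Lemma closed_side_ge0 P s : closed [set x | forall i, 0 <= side P s i x].
Proof.
rewrite (_ : [set x | _] = \bigcap_(i in [set: 'I_5]) (side P s i @^-1` [set y | 0 <= y])); last first.
  by apply/seteqP; split => x /= h i; [move=> _|]; exact: h.
apply: closed_bigI => i _; apply: closed_comp; last exact: closed_ge.
by move=> y _; exact: side_continuous.
Qed.

Lemma bounded_triangle p q r : bounded_set (triangle p q r).
Proof.
exists (`|p| + `|q| + `|r|); split; first exact: num_real.
move=> M ltM x [a [b [c [a0 b0 c0 abc ->]]]]; apply: le_trans (ltW ltM).
apply: le_trans (ler_normD _ _) _; rewrite lerD //; last first.
  by rewrite normrZ ger0_norm // ler_piMl //; lra.
apply: le_trans (ler_normD _ _) _.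
by rewrite !normrZ (ger0_norm a0) (ger0_norm b0) lerD // ler_piMl //; lra.
Qed.

Lemma bounded_setU2 (A B : set (R * R)) : bounded_set A -> bounded_set B -> bounded_set (A `|` B).
Proof.
move=> [M [_ hM]] [M' [_ hM']]; exists (Num.max M M'); split; first exact: num_real.
by move=> N; rewrite gt_max => /andP[h h'] x [|]; [exact: hM | exact: hM'].
Qed.

(* The open polygon is clopen in the complement of its boundary. *)
Lemma side_gt0_region P s x : strictly_convex P s -> (forall i, 0 < side P s i x) -> region P x.
Proof.
move=> cP hx; right.
have nb : (~` boundary P) x.
  move=> [i _ [t t01 xE]]; have := hx i; rewrite xE.
  by rewrite (_ : side _ _ _ _ = 0) ?ltxx // /side /cross !coordE; ring.
split => //.
set C := connected_component _ x.
pose U := [set y : R * R | forall i, 0 < side P s i y].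
pose H := [set y : R * R | forall i, 0 <= side P s i y].
have UH : C `&` U = C `&` H.
  apply/seteqP; split => y [Cy hy]; split => // i; first exact/ltW/hy.
  rewrite lt_neqAle hy andbT eq_sym; apply/eqP => h0.
  have := @connected_component_sub _ (~` boundary P) x y Cy; apply.
  by exists i => //; exact: (side_boundary cP).
have CU : C `&` U = C.
  apply: (component_connected (A := ~` boundary P) (x := x)).
  - by exists x; split => //; exact: connected_component_refl.
  - by exists U => //; exact: open_side_gt0.
  - by exists H; [exact: closed_side_ge0 | rewrite -UH].
apply: (@bounded_set_sub _ _ (triangle (P 0) (P (ordS 0)) (P (ordS (ordS 0))) `|`
  triangle (P 0) (P (ordS (ordS 0))) (P (ordS (ordS (ordS 0)))) `|`
  triangle (P 0) (P (ordS (ordS (ordS 0)))) (P (ordS (ordS (ordS (ordS 0))))))).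
  rewrite -CU => y [_ hy]; apply: (@side_fan P s 0 y cP) => i; exact/ltW/hy.
by do 2?apply: bounded_setU2; exact: bounded_triangle.
Qed.

Lemma side_gt0_interior P s x : strictly_convex P s -> (forall i, 0 < side P s i x) ->
  (region P)° x.
Proof.
move=> cP hx; have : open [set x | forall i, 0 < side P s i x] by exact: open_side_gt0.
by rewrite openE => /(_ x hx); apply: interiorS => y; exact: side_gt0_region.
Qed.

(** The areas of the fan triangles are regrouped into the corner triangle [v a d] and the
    quadrilateral [a b c d], the cut that the angle bound at [v] requires. *)
Lemma area_le_strictly_convex P s i : `|s| = 1 -> strictly_convex P s ->
  let v := P i in let a := P (ordS i) in let b := P (ordS (ordS i)) in
  let c := P (ordS (ordS (ordS i))) in let d := P (ordS (ordS (ordS (ordS i)))) in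
  area_le (region P) ((s * cross (a - v) (d - v) + s * (cross (b - a) (c - a) + cross (c - a) (d - a))) / 2).
Proof.
move=> s1 cP v a b c d.
have [n1 n2 n3 n4] := ordS5_neq i.
have pos k j : j != k -> j != ordS k -> 0 < s * cross (P (ordS k) - P k) (P j - P k) by exact: cP.
have t1 : 0 < s * cross (a - v) (b - v) by apply: pos; rewrite ?(inj_eq ordS5_inj).
have t2 : 0 < s * cross (b - v) (c - v).
  have -> : cross (b - v) (c - v) = cross (c - b) (v - b) by rewrite /cross !coordE; ring.
  by apply: (pos (ordS (ordS i))); rewrite eq_sym.
have t3 : 0 < s * cross (c - v) (d - v).
  have -> : cross (c - v) (d - v) = cross (d - c) (v - c) by rewrite /cross !coordE; ring.
  by apply: (pos (ordS (ordS (ordS i)))); rewrite eq_sym.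
have nE u : 0 < s * u -> `|u| = s * u by move=> su; rewrite -(gtr0_norm su) normrM s1 mul1r.
apply: (area_le_sub _ _ (area_leU (area_leU (area_le_triangle v a b) (area_le_triangle v b c)) (area_le_triangle v c d))).
  by move=> x rx; apply: (@side_fan P s i x cP) => j; exact: region_side.
rewrite (nE _ t1) (nE _ t2) (nE _ t3) -!mulrDl le_eqVlt; apply/orP; left; apply/eqP; congr (_ / 2).
by rewrite /cross !coordE; ring.
Qed.

End ConvexPentagon.

(** * Convexity and angles of efficient pentagons *)

Section EfficientPentagon.
Variable R : realType.
Implicit Types (P : polygon5 R) (x y p q r m : R * R) (s t : R).

Lemma sum_ord5 (V : nmodType) (i : 'I_5) (f : 'I_5 -> V) :
  \sum_j f j = f i + f (ordS i) + f (ordS (ordS i)) + f (ordS (ordS (ordS i)))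
    + f (ordS (ordS (ordS (ordS i)))).
Proof.
rewrite (perm_big [:: i; ordS i; ordS (ordS i); ordS (ordS (ordS i)); ordS (ordS (ordS (ordS i)))]) /=.
  by rewrite !big_cons big_nil addr0 !addrA.
apply: uniq_perm; first exact: index_enum_uniq.
  by case: i => [[|[|[|[|[|]]]]] //= ?].
by move=> j; rewrite mem_index_enum ord5_split.
Qed.

Lemma subhull_vertex (I : finType) (Q : I -> R * R) (i j : I) : j != i -> subhull Q i (Q j).
Proof.
move=> ji; exists (fun k => (k == j)%:R); split => [k|||].
- by rewrite ler0n.
- by rewrite eq_sym (negbTE ji).
- by rewrite (bigD1 j) //= eqxx big1 ?addr0 // => k /negbTE ->.
- by rewrite (bigD1 j) //= eqxx scale1r big1 ?addr0 // => k /negbTE ->; rewrite scale0r.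
Qed.

Lemma subhull_segment (I : finType) (Q : I -> R * R) (i : I) x y :
  subhull Q i x -> subhull Q i y -> segment x y `<=` subhull Q i.
Proof.
move=> [l [l0 li l1 ->]] [k [k0 ki k1 ->]] z [t /andP[t0 t1] ->].
exists (fun n => (1 - t) * l n + t * k n); split => [n|||].
- by rewrite addr_ge0 // mulr_ge0 // subr_ge0.
- by rewrite li ki !mulr0 addr0.
- by rewrite big_split /= -!mulr_sumr l1 k1 !mulr1 subrK.
- under [RHS]eq_bigr do rewrite scalerDl -!scalerA.
  rewrite big_split /= -!scaler_sumr scalerBr scalerBl scale1r.
  by rewrite -addrA [in RHS]addrA -addrA [- _ + _]addrC.
Qed.

Lemma line_trichotomy p q t (m := p + t *: (q - p)) :
  [\/ segment p q m, segment p m q | segment q m p].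
Proof.
have [t0|t0] := ltrP t 0.
  constructor 3; have t1 : 1 - t != 0 by rewrite gt_eqF //; lra.
  exists (1 - t)^-1; last by apply: eq_coord; rewrite /m !coordE; field.
  by rewrite invr_ge0 invf_le1; lra.
have [t1|t1] := lerP t 1; first by constructor 1; exists t; rewrite // t0.
constructor 2; have tn0 : t != 0 by rewrite gt_eqF //; lra.
exists t^-1; last by apply: eq_coord; rewrite /m !coordE; field.
by rewrite invr_ge0 t0 invf_le1; lra.
Qed.

Lemma line_crossing p q x y : cross (q - p) (x - p) * cross (q - p) (y - p) < 0 ->
  exists2 m, segment x y m & [\/ segment p q m, segment p m q | segment q m p].
Proof.
set a := cross _ (x - p); set b := cross _ (y - p) => ab.
have ab0 : a - b != 0.
  by rewrite subr_eq0; apply: contraTneq ab => ->; rewrite -expr2 -leNgt sqr_ge0.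
have pq : q - p != 0.
  by apply: contraTneq ab => e; rewrite /a e /cross /= !mul0r subr0 mul0r ltxx.
pose t := a / (a - b); pose m := x + t *: (y - x).
have c0 : cross (q - p) (m - p) = 0.
  have -> : cross (q - p) (m - p) = (1 - t) * a + t * b.
    by rewrite /m /a /b /cross !coordE; ring.
  by rewrite /t; field.
exists m.
  exists t => //; rewrite /t; have [a0|a0] := ltrP a 0.
    have b0 : 0 < b by nra.
    by rewrite -mulrNN -invrN divr_ge0 ?ler_pdivrMr /=; lra.
  have b0 : b < 0 by nra.
  by rewrite divr_ge0 ?ler_pdivrMr /=; lra.
have := cross_eq0 pq c0; set r := _ / _ => mE.
have -> : m = p + r *: (q - p) by rewrite -mE addrC subrK.
exact: line_trichotomy.
Qed.

Section SimplePentagon.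
Variable P : polygon5 R.
Hypotheses (sP : simple_pentagon P) (nhull : forall i, ~ subhull P i (P i)).

Lemma noncollinear (i j k : 'I_5) : i != j -> i != k -> j != k ->
  cross (P j - P i) (P k - P i) != 0.
Proof.
move=> ij ik jk; apply/eqP => c0.
have pq : P j - P i != 0 by rewrite subr_eq0 (inj_eq sP.1) eq_sym.
have := cross_eq0 pq c0; set r := _ / _ => mE.
have kE : P k = P i + r *: (P j - P i) by rewrite -mE addrC subrK.
have := line_trichotomy (P i) (P j) r; rewrite /= -kE => -[] h.
- by apply: (nhull (subhull_segment _ _ h)); apply: subhull_vertex.
- by apply: (nhull (subhull_segment _ _ h)); apply: subhull_vertex; rewrite // eq_sym.
- by apply: (nhull (subhull_segment _ _ h)); apply: subhull_vertex; rewrite // eq_sym.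
Qed.

(** Otherwise edge [j] crosses the line of edge [i] in some [m]. If [m] is on edge [i], simplicity
    fails; if [m] is beyond an endpoint of edge [i], that endpoint lies between the other one and
    [m], hence in the hull of the other vertices. *)
Lemma edge_same_side (i j : 'I_5) : j != i -> j != ordS i -> ordS j != i ->
  0 < cross (P (ordS i) - P i) (P j - P i) * cross (P (ordS i) - P i) (P (ordS j) - P i).
Proof.
move=> ji jSi Sji; have [n1 n2 n3 n4] := ordS5_neq i.
have Sij : ordS j != ordS i by rewrite (inj_eq ordS5_inj).
rewrite lt_neqAle eq_sym mulf_neq0 ?noncollinear // 1?eq_sym //=.
rewrite leNgt; apply/negP => /line_crossing [m hm].
have vtx k l : l != k -> subhull P k (P l) by exact: subhull_vertex.
case=> h.
- have := sP.2 i j m; rewrite eq_sym => /(_ ji h hm) [[/eqP]|[/eqP]].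
    by rewrite (negbTE jSi).
  by rewrite eq_sym (negbTE Sji).
- apply: (nhull (i := ordS i)); apply: (subhull_segment _ _ h); first by apply: vtx; rewrite eq_sym.
  by apply: (subhull_segment _ _ hm); apply: vtx.
- apply: (nhull (i := i)); apply: (subhull_segment _ _ h); first exact: vtx.
  by apply: (subhull_segment _ _ hm); apply: vtx.
Qed.

(** For each edge the other three vertices lie on one side of its line. Edges [i] and [i + 1] both
    see the triangle on the vertices [i], [i + 1], [i + 2], whose orientation is [T i], so the sign
    propagates around the cycle. *)
Lemma simple_strictly_convex : exists2 s, `|s| = 1 & strictly_convex P s.
Proof.
pose T i := cross (P (ordS i) - P i) (P (ordS (ordS i)) - P i).
have same i : (0 < T i * cross (P (ordS i) - P i) (P (ordS (ordS (ordS i))) - P i)) &&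
    (0 < T i * cross (P (ordS i) - P i) (P (ordS (ordS (ordS (ordS i)))) - P i)).
  have [n1 n2 n3 n4] := ordS5_neq i.
  have h1 := @edge_same_side i (ordS (ordS i)) n2 ltac:(by rewrite (inj_eq ordS5_inj)) n3.
  have h2 := @edge_same_side i (ordS (ordS (ordS i))) n3 ltac:(by rewrite (inj_eq ordS5_inj)) n4.
  move: h1 h2; rewrite -/(T i); move: (T i) (cross _ _) (cross _ _) => a b c h1 h2.
  rewrite h1 /=; have [b0|b0] := ltrP b 0; nra.
have TS i : 0 < T i * T (ordS i).
  have /andP[_] := same (ordS i); rewrite ordS5K.
  rewrite (_ : cross _ (P i - _) = T i) 1?mulrC // /T /cross !coordE; ring.
have T0 : T 0 != 0 by apply: contraTneq (TS 0) => ->; rewrite mul0r ltxx.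
exists (Num.sg (T 0)); first by rewrite normr_sg T0.
have sgS i : 0 < Num.sg (T 0) * T i -> 0 < Num.sg (T 0) * T (ordS i).
  by have := TS i; move: (Num.sg _) (T i) (T (ordS i)) => a b c h1 h2; have [a0|a0] := ltrP a 0; nra.
have sg0 : 0 < Num.sg (T 0) * T 0.
  by rewrite -normrEsg normr_gt0.
have sg i : 0 < Num.sg (T 0) * T i.
  have s1 := sgS _ sg0; have s2 := sgS _ s1; have s3 := sgS _ s2; have s4 := sgS _ s3.
  by have := ord5_split 0 i; rewrite !inE => /orP[/eqP ->|/or4P[] /eqP ->].
move=> i j ji jSi; rewrite /side.
have := sg i; have /andP[] := same i.
have := ord5_split i j; rewrite !inE (negbTE ji) (negbTE jSi) /= => /or3P[] /eqP -> //.
  by move: (Num.sg _) (T i) (cross _ _) (cross _ _) => a b c d h1 h2 h3; have [a0|a0] := ltrP a 0; nra.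
by move: (Num.sg _) (T i) (cross _ _) (cross _ _) => a b c d h1 h2 h3; have [a0|a0] := ltrP a 0; nra.
Qed.
End SimplePentagon.
End EfficientPentagon.

(** * Area bounds in terms of side lengths *)

Section EfficientBounds.
Variable R : realType.
Implicit Types (P : polygon5 R) (a b c d v : R * R).

Lemma amgm3 (x y z : R) : 0 <= x -> 0 <= y -> 0 <= z -> 27 * (x * y * z) <= (x + y + z) ^+ 3.
Proof.
move=> x0 y0 z0.
have h (p q r : R) : 0 <= p -> 0 <= p * (q - r) ^+ 2 by move=> p0; rewrite mulr_ge0 // sqr_ge0.
have := h _ x y x0; have := h _ x z x0; have := h _ y z x0.
have := h _ x y y0; have := h _ x z y0; have := h _ y z y0.
have := h _ x y z0; have := h _ x z z0; have := h _ y z z0.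
lra.
Qed.

(** For signed angles alpha and gamma the left side is - cos (alpha + gamma) times the right side:
    the sole inequality in the proof of Bretschneider's bound. *)
Lemma ler_cross_dot (u v u' v' : R * R) :
  cross u v * cross u' v' - dot u v * dot u' v' <= enorm u * enorm v * (enorm u' * enorm v').
Proof.
apply: le_trans (ler_norm _) _.
rewrite -(ler_pXn2r (n := 2)) ?nnegrE ?mulr_ge0 ?enorm_ge0 //.
rewrite [leRHS]exprMn -!lagrange_dot_cross real_normK ?num_real //.
move: (cross u v) (dot u v) (cross u' v') (dot u' v') => X x Y y.
rewrite -subr_ge0 (_ : _ - _ = (X * y + x * Y) ^+ 2) ?sqr_ge0 //; ring.
Qed.

(* Bretschneider's inequality for the quadrilateral abcd, then AM-GM on three
   of its four factors. *)
Lemma quad_area_bound a b c d (w := enorm (a - d))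
    (p := enorm (b - a) + enorm (c - b) + enorm (d - c))
    (K := cross (b - a) (c - a) + cross (c - a) (d - a)) :
  27 * (2 * K) ^+ 2 <= (p - w) * (p + 3 * w) ^+ 3.
Proof.
rewrite {}/p {}/w.
have KE : K = cross (b - a) (d - a) + cross (d - c) (b - c).
  by rewrite /K /cross !coordE; ring.
have := ler_cross_dot (b - a) (d - a) (d - c) (b - c).
have L1 := lagrange_dot_cross (b - a) (d - a).
have L2 := lagrange_dot_cross (d - c) (b - c).
have tx : enorm (b - a) <= enorm (c - b) + enorm (d - c) + enorm (a - d).
  have := ler_enorm_dist d a b; have := ler_enorm_dist c d b.
  rewrite (enorm_distC d a) (enorm_distC c d) (enorm_distC b c); lra.
have ty : enorm (c - b) <= enorm (b - a) + enorm (d - c) + enorm (a - d).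
  have := ler_enorm_dist a b c; have := ler_enorm_dist d a c.
  rewrite (enorm_distC a b) (enorm_distC d a) (enorm_distC c d); lra.
have tz : enorm (d - c) <= enorm (b - a) + enorm (c - b) + enorm (a - d).
  have := ler_enorm_dist a c d; have := ler_enorm_dist b a c.
  rewrite (enorm_distC a c) (enorm_distC d a); lra.
have tw : enorm (a - d) <= enorm (b - a) + enorm (c - b) + enorm (d - c).
  have := ler_enorm_dist b a d; have := ler_enorm_dist c b d.
  rewrite (enorm_distC d a); lra.
(* Both sides are the squared length of the diagonal [b d]. *)
have cosines : enorm (b - a) ^+ 2 + enorm (a - d) ^+ 2 - 2 * dot (b - a) (d - a) =
    enorm (c - b) ^+ 2 + enorm (d - c) ^+ 2 - 2 * dot (d - c) (b - c).
  by rewrite !sqr_enorm /dot !coordE; ring.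
move: L1 L2; rewrite KE (enorm_distC d a) (enorm_distC b c).
have x0 := enorm_ge0 (b - a); have y0 := enorm_ge0 (c - b).
have z0 := enorm_ge0 (d - c); have w0 := enorm_ge0 (a - d).
move: x0 y0 z0 w0 cosines tx ty tz tw.
move: (enorm (b - a)) (enorm (c - b)) (enorm (d - c)) (enorm (a - d)) => x y z w.
move: (cross (b - a) (d - a)) (cross (d - c) _) (dot (b - a) _) (dot (d - c) _) => C1 C2 d1 d2.
move=> x0 y0 z0 w0 cosines tx ty tz tw L1 L2 h.
(* [C1 + C2] is twice the signed area, so this bounds 16 times its square by the product known from
   Brahmagupta's formula. *)
have key : (2 * (C1 + C2)) ^+ 2 <= (w + x + y - z) * (w + x + z - y) * (w + y + z - x) * (x + y + z - w).
  have -> : (w + x + y - z) * (w + x + z - y) * (w + y + z - x) * (x + y + z - w) =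
    4 * (x * w + z * y) ^+ 2 - (x ^+ 2 + w ^+ 2 - (y ^+ 2 + z ^+ 2)) ^+ 2 by ring.
  have -> : x ^+ 2 + w ^+ 2 - (y ^+ 2 + z ^+ 2) = 2 * (d1 - d2) by lra.
  have -> : 4 * (x * w + z * y) ^+ 2 = 4 * (d1 ^+ 2 + C1 ^+ 2) + 4 * (d2 ^+ 2 + C2 ^+ 2) + 8 * (x * w * (z * y)).
    by rewrite L1 L2; ring.
  clear -h; lra.
have [h1 h2 h3] : [/\ 0 <= w + x + y - z, 0 <= w + x + z - y & 0 <= w + y + z - x] by split; lra.
have h4 : 0 <= x + y + z - w by lra.
have := amgm3 h1 h2 h3.
rewrite (_ : w + x + y - z + (w + x + z - y) + (w + y + z - x) = x + y + z + 3 * w); last by ring.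
move=> am; have {}am := ler_wpM2l h4 am.
apply: le_trans am; rewrite (_ : (x + y + z - w) * (27 * _) = 27 * ((w + x + y - z) * (w + x + z - y) * (w + y + z - x) * (x + y + z - w))); last by ring.
by rewrite ler_pM2l.
Qed.

Definition corner_cos P (i : 'I_5) : R :=
  let u := P (ordS i) - P i in let w := P (ord_pred i) - P i in
  dot u w / (enorm u * enorm w).

Lemma cairo_perimeter_le : 2 * Num.sqrt (2 + Num.sqrt 3) <= 483 / 125 :> R.
Proof.
have sqrt_le (x y : R) : 0 <= y -> x <= y ^+ 2 -> Num.sqrt x <= y.
  by move=> y0 xy; rewrite -(ger0_norm y0) -sqrtr_sqr ler_wsqrtr.
(* A rational bound on sqrt 3 sharp enough that 2 plus it stays below (483/250)^2. *)
have h3 : Num.sqrt 3 <= 26 / 15 - 1 / 1000 :> R by apply: sqrt_le; lra.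
have : Num.sqrt (2 + Num.sqrt 3) <= 483 / 250 :> R by apply: sqrt_le; lra.
lra.
Qed.

Lemma perimeterE P (i : 'I_5) : perimeter P =
  enorm (P (ordS i) - P i) + enorm (P (ordS (ordS i)) - P (ordS i)) +
  enorm (P (ordS (ordS (ordS i))) - P (ordS (ordS i))) +
  enorm (P (ordS (ordS (ordS (ordS i)))) - P (ordS (ordS (ordS i)))) +
  enorm (P i - P (ordS (ordS (ordS (ordS i))))).
Proof. by rewrite /perimeter (sum_ord5 i) ordS5K. Qed.

(** The region would lie in the hull of the other four vertices, whose cycle is no longer than the
    pentagon. The quadrilateral bound and AM-GM then give an area of at most (perimeter / 4)^2, and
    483/125 < 4. *)
Lemma efficient_not_subhull P (i : 'I_5) : efficient P -> ~ subhull P i (P i).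
Proof.
move=> [sP aP pP] hi.
have [n1 n2 n3 n4] := ordS5_neq i.
set a := P (ordS i); set b := P (ordS (ordS i)); set c := P (ordS (ordS (ordS i))).
set d := P (ordS (ordS (ordS (ordS i)))).
have ab : a != b by rewrite (inj_eq sP.1) (inj_eq ordS5_inj) eq_sym.
have sub : region P `<=` hull (quad a b c d).
  apply: (@subset_trans _ (subhull P i)); last first.
    move=> x [l [l0 li l1 ->]].
    exists (fun k : 'I_4 => [:: l (ordS i); l (ordS (ordS i)); l (ordS (ordS (ordS i)));
       l (ordS (ordS (ordS (ordS i))))]`_k); split.
    - by case=> [[|[|[|[|]]]]] //= ?; exact: l0.
    - by rewrite sum_ord4 /= -l1 (sum_ord5 i) li add0r.
    - by rewrite sum_quad /= (sum_ord5 i) li scale0r add0r.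
  apply: region_sub_convex => [x y|j]; first exact: subhull_segment.
  by have [->|ji] := eqVneq j i; [exact: hi | exact: subhull_vertex].
have := area_le_product (area_le_sub sub (lexx _) (area_le_quad_hull c d ab)).
move: aP; rewrite /area => ->; rewrite lee_fin; apply/negP; rewrite -ltNge.
have := cairo_perimeter_le; move: pP; rewrite (perimeterE P i) -/a -/b -/c -/d => pP.
have := ler_enorm_dist (P i) d a.
have := enorm_ge0 (b - a); have := enorm_ge0 (c - b); have := enorm_ge0 (d - c); have := enorm_ge0 (a - d).
have := enorm_ge0 (a - P i); have := enorm_ge0 (P i - d).
move: pP; move: (enorm (b - a)) (enorm (c - b)) (enorm (d - c)) (enorm (a - d)) (enorm (a - _)) (enorm (_ - d)).
move=> x y z w u v pP v0 u0 w0 z0 y0 x0 tri bound.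
have L4 : x + y + z + w <= 483 / 125 by clear -pP tri bound; lra.
have am : 4 * ((x + z) * (y + w)) <= (x + y + z + w) ^+ 2.
  rewrite -subr_ge0 (_ : _ - _ = (x + z - y - w) ^+ 2) ?sqr_ge0 //; ring.
have sq : (x + y + z + w) ^+ 2 <= (483 / 125) ^+ 2 by rewrite ler_pXn2r // nnegrE; lra.
clear -am sq; lra.
Qed.

Lemma efficient_strictly_convex P : efficient P -> exists2 s, `|s| = 1 & strictly_convex P s.
Proof.
move=> eP; apply: simple_strictly_convex; first by case: eP.
by move=> i; exact: efficient_not_subhull.
Qed.

(** 61/200 is slightly below cos (2 pi / 5), about 0.309. A larger cosine makes the squared tangent
    of the half-angle at most 139/261 < (73/100)^2, and [tri_quad_area_lt4] then forces an area
    below 1. *)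
Lemma efficient_corner_cos P (i : 'I_5) : efficient P -> corner_cos P i < 61 / 200.
Proof.
move=> eP; have [s s1 cP] := efficient_strictly_convex eP.
have [sP aP pP] := eP.
have [n1 n2 n3 n4] := ordS5_neq i.
have := area_le_product (area_le_strictly_convex i s1 cP).
move: aP; rewrite /area => ->; rewrite lee_fin /corner_cos ord_pred5E.
have d0 : P (ordS (ordS (ordS (ordS i)))) - P i != 0 by rewrite subr_eq0 (inj_eq sP.1).
have a0 : P (ordS i) - P i != 0 by rewrite subr_eq0 (inj_eq sP.1).
have := cairo_perimeter_le; move: pP; rewrite (perimeterE P i).
move: a0 d0; set a := P (ordS i); set b := P (ordS (ordS i)); set c := P (ordS (ordS (ordS i))).
set d := P (ordS (ordS (ordS (ordS i)))); set v := P i => a0 d0 pP bound.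
have u0 := enorm_gt0 a0; have w0 := enorm_gt0 d0.
set K := cross (b - a) (c - a) + cross (c - a) (d - a).
have ss : s ^+ 2 = 1 by rewrite -[LHS]real_normK ?num_real // s1 expr1n.
move=> ar; rewrite ltNge; apply/negP => hcos.
have uw0 := mulr_gt0 u0 w0.
have hdot : 61 / 200 * (enorm (a - v) * enorm (d - v)) <= dot (a - v) (d - v).
  by rewrite -ler_pdivlMr.
have := lagrange_dot_cross (a - v) (d - v).
have wE : enorm (a - d) ^+ 2 = enorm (a - v) ^+ 2 + enorm (d - v) ^+ 2 - 2 * dot (a - v) (d - v).
  by rewrite !sqr_enorm /dot !coordE; ring.
have quadb : 27 * (2 * (s * K)) ^+ 2 <=
    (enorm (b - a) + enorm (c - b) + enorm (d - c) - enorm (a - d)) *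
    (enorm (b - a) + enorm (c - b) + enorm (d - c) + 3 * enorm (a - d)) ^+ 3.
  rewrite (_ : (2 * (s * K)) ^+ 2 = (2 * K) ^+ 2); first exact: quad_area_bound.
  by rewrite !exprMn ss mul1r.
have tw : enorm (a - d) <= enorm (a - v) + enorm (d - v).
  by rewrite [leRHS]addrC (enorm_distC d v); exact: ler_enorm_dist.
have tp : enorm (a - d) <= enorm (b - a) + enorm (c - b) + enorm (d - c).
  have := ler_enorm_dist b a d; have := ler_enorm_dist c b d.
  rewrite (enorm_distC a d); lra.
move: pP ar; rewrite (enorm_distC v d).
have W0 := enorm_ge0 (a - d).
move: u0 w0 uw0 hdot wE quadb tw tp W0.
move: (cross (a - v) (d - v)) (dot (a - v) (d - v)) (enorm (a - v)) (enorm (d - v)) (enorm (a - d)).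
move: (enorm (b - a)) (enorm (c - b)) (enorm (d - c)).
move=> x y z X D U V W U0 V0 UV0 hdot wE quadb tw tp W0 pP ar lag.
have XE : (s * X) ^+ 2 = (U * V - D) * (U * V + D).
  by rewrite exprMn ss mul1r; transitivity ((U * V) ^+ 2 - D ^+ 2); [rewrite -lag; ring | ring].
have SW : (U + V) ^+ 2 - W ^+ 2 = 2 * (U * V + D) by rewrite wE; ring.
have UVD : 0 < U * V + D by clear -UV0 hdot; lra.
have := @tri_quad_area_lt4 R (U + V) (x + y + z) W (2 * (s * X)) (2 * (s * K)).
have h1 : U + V + (x + y + z) <= 483 / 125 by clear -pP bound; lra.
(* Four times the area of the corner triangle is (U + V)^2 - W^2 times the tangent of half the angle
   at [v]. *)
have h2 : 2 * (s * X) <= 73 / 100 * ((U + V) ^+ 2 - W ^+ 2).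
  rewrite SW [leRHS]mulrCA ler_pM2l //.
  have r0 : 0 <= 73 / 100 * (U * V + D) by rewrite mulr_ge0 // ltW.
  apply: le_trans (ler_norm _) _.
  rewrite -(ler_pXn2r (n := 2)) ?nnegrE // real_normK ?num_real // XE exprMn expr2 mulrA.
  rewrite [leRHS](_ : _ = (73 / 100 * (73 / 100) * (U * V + D)) * (U * V + D)); last by ring.
  by rewrite ler_pM2r //; clear -hdot UV0; lra.
(* Heron's formula: among triangles with given [W] and [U + V], the isosceles one is largest. *)
have h3 : (2 * (s * X)) ^+ 2 <= W ^+ 2 * ((U + V) ^+ 2 - W ^+ 2).
  rewrite exprMn XE SW (_ : 2 ^+ 2 * _ = 2 * (U * V - D) * (2 * (U * V + D))); last by ring.
  rewrite ler_pM2r ?mulr_gt0 // wE -subr_ge0.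
  by rewrite (_ : _ - _ = (U - V) ^+ 2) ?sqr_ge0 //; ring.
move=> /(_ W0 tw tp h1 h2 h3 quadb).
clear -ar; lra.
Qed.
End EfficientBounds.

(** * Sums of angles around a point *)

Section CircleMeasure.
Variable R : realType.
Implicit Types (u v w d : R * R) (a b t phi : R).
Local Notation mu := (@lebesgue_measure R).

Definition dir t : R * R := (cos t, sin t).

Definition vangle u v : R := acos (dot u v / (enorm u * enorm v)).

Definition open_cone u v : set (R * R) :=
  [set d | exists a b, [/\ 0 < a, 0 < b & d = a *: u + b *: v]].

Definition closed_cone u v : set (R * R) :=
  [set d | exists a b, [/\ 0 <= a, 0 <= b & d = a *: u + b *: v]].

(** The angles strictly between [a] and [b], reduced to [0, 2 pi): an arc that passes the direction
    0 continues in the second interval, which is empty when [b <= 2 * pi]. *)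
Definition arc a b : set R :=
  `]a, Num.min b (2 * pi)[ `|` `[0, b - 2 * pi[.

Definition closed_arc a b : set R :=
  `[a, Num.min b (2 * pi)] `|` `[0, b - 2 * pi].

Lemma twopi_gt0 : 0 < 2 * pi :> R.
Proof. by rewrite mulr_gt0 // pi_gt0. Qed.

Lemma sin_dir a t : cross (dir a) (dir t) = sin (t - a).
Proof. by rewrite /cross /dir sinB /=; ring. Qed.

Lemma dirD2pi t : dir (t + 2 * pi) = dir t.
Proof. by rewrite /dir mulr_natl cosD2pi sinD2pi. Qed.

Lemma cos_vangle_bound u v : u != 0 -> v != 0 ->
  -1 <= dot u v / (enorm u * enorm v) <= 1.
Proof.
move=> u0 v0; have uv : 0 < enorm u * enorm v by rewrite mulr_gt0 // enorm_gt0.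
by rewrite -ler_norml normrM normfV (gtr0_norm uv) ler_pdivrMr // mul1r ler_norm_dot.
Qed.

Lemma polar u : u != 0 -> exists2 a, 0 <= a < 2 * pi & u = enorm u *: dir a.
Proof.
move=> u0; have n0 := enorm_gt0 u0; have nn0 := gt_eqF n0.
pose x := u.1 / enorm u; pose y := u.2 / enorm u.
have xy : x ^+ 2 + y ^+ 2 = 1.
  rewrite !exprMn -mulrDl exprVn sqr_enorm /dot -!expr2 divff // !expr2.
  by rewrite -/(dot u u) -sqr_enorm expf_eq0 nn0.
have uE a : dir a = (x, y) -> u = enorm u *: dir a.
  by move=> ->; apply: eq_coord; rewrite !coordE /= mulrC divfK // nn0.
have x1 : -1 <= x <= 1.
  rewrite -ler_norml -(ler_pXn2r (n := 2)) ?nnegrE // real_normK ?num_real // expr1n -xy.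
  by rewrite lerDl sqr_ge0.
have sx : Num.sqrt (1 - x ^+ 2) = `|y|.
  by rewrite -xy addrAC subrr add0r sqrtr_sqr.
have xb : x \in `[-1, 1] by rewrite in_itv.
have pi0 := pi_gt0 R.
have [y0|y0] := lerP 0 y.
  exists (acos x).
    by rewrite acos_ge0 //= (le_lt_trans (acos_lepi x1)) // mulr_natl mulr2n ltrDl.
  by apply: uE; rewrite /dir acosK // sin_acos // sx ger0_norm.
exists (2 * pi - acos x).
  have ax : 0 < acos x.
    apply: acos_gt0; case/andP: x1 => -> /=; rewrite le_eqVlt => /orP[/eqP xe|//].
    by move: xy; rewrite xe expr1n => /eqP; rewrite addrC -subr_eq0 addrK sqrf_eq0 => /eqP y00; rewrite y00 ltxx in y0.
  by have := acos_lepi x1; move: ax pi0; move: (acos x) => z *; apply/andP; split; lra.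
apply: uE; rewrite /dir addrC mulr_natl cosD2pi sinD2pi cosN sinN acosK // sin_acos // sx.
by rewrite ltr0_norm // opprK.
Qed.

(** [vangle] is unoriented; the positive cross product is what places [v] counterclockwise from
    [u]. *)
Lemma polar2 u v : 0 < cross u v -> exists2 a, 0 <= a < 2 * pi &
  [/\ 0 < vangle u v < pi, u = enorm u *: dir a & v = enorm v *: dir (a + vangle u v)].
Proof.
move=> c0.
have u0 : u != 0 by apply: contraTneq c0 => ->; rewrite /cross /= !mul0r subrr ltxx.
have v0 : v != 0 by apply: contraTneq c0 => ->; rewrite /cross /= !mulr0 subrr ltxx.
have un := enorm_gt0 u0; have vn := enorm_gt0 v0.
have uv0 : 0 < enorm u * enorm v by rewrite mulr_gt0.
have cb := cos_vangle_bound u0 v0.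
have [a ab uE] := polar u0; exists a => //.
have c2 : 1 - (dot u v / (enorm u * enorm v)) ^+ 2 = (cross u v / (enorm u * enorm v)) ^+ 2.
  rewrite !expr_div_n; apply/eqP; rewrite subr_eq addrC -mulrDl lagrange_dot_cross divff //.
  by rewrite expf_neq0 // gt_eqF.
have sE : sin (vangle u v) = cross u v / (enorm u * enorm v).
  by rewrite /vangle sin_acos // c2 sqrtr_sqr ger0_norm // divr_ge0 // ltW.
have cE : cos (vangle u v) = dot u v / (enorm u * enorm v).
  by rewrite /vangle acosK // in_itv.
have s0 : 0 < sin (vangle u v) by rewrite sE divr_gt0.
split => //.
  rewrite !lt_neqAle acos_ge0 // acos_lepi // !andbT eq_sym; apply/andP; split.
    by apply: contraTneq s0 => h; rewrite h sin0 ltxx.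
  by apply: contraTneq s0 => h; rewrite h sinpi ltxx.
have n0 : enorm u * enorm v != 0 by rewrite gt_eqF.
have un0 : enorm u != 0 by rewrite gt_eqF.
have vn0 : enorm v != 0 by rewrite gt_eqF.
have D1 : enorm v * cos (vangle u v) = cos a * v.1 + sin a * v.2.
  apply: (mulfI un0); rewrite cE; transitivity (dot u v); first by field; rewrite ?un0 ?vn0.
  by rewrite {1}uE /dot !coordE /=; ring.
have D2 : enorm v * sin (vangle u v) = cos a * v.2 - sin a * v.1.
  apply: (mulfI un0); rewrite sE; transitivity (cross u v); first by field; rewrite ?un0 ?vn0.
  by rewrite {1}uE /cross !coordE /=; ring.
have cs := cos2Dsin2 a.
apply: eq_coord; rewrite !coordE /= ?cosD ?sinD.
  transitivity (cos a * (enorm v * cos (vangle u v)) - sin a * (enorm v * sin (vangle u v))); last by ring.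
  by rewrite D1 D2 -[LHS]mul1r -cs; ring.
transitivity (sin a * (enorm v * cos (vangle u v)) + cos a * (enorm v * sin (vangle u v))); last by ring.
by rewrite D1 D2 -[LHS]mul1r -cs; ring.
Qed.

Lemma arcP a phi t : 0 <= a < 2 * pi -> 0 < phi < pi -> arc a (a + phi) t ->
  exists2 x, 0 < x < phi & dir t = dir (a + x).
Proof.
move=> /andP[a0 a1] /andP[p0 p1] [] /=; rewrite in_itv /= => /andP[].
  rewrite lt_min => h /andP[h' _]; exists (t - a); first by rewrite subr_gt0 h ltrBlDl.
  by rewrite addrC subrK.
move=> h h'; exists (t + 2 * pi - a); last by rewrite (_ : a + (t + 2 * pi - a) = t + 2 * pi) ?dirD2pi //; ring.
by apply/andP; split; lra.
Qed.

Lemma closed_arcP a phi t : 0 <= a < 2 * pi -> 0 < phi < pi -> 0 <= t < 2 * pi ->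
  ~ closed_arc a (a + phi) t -> exists2 x, phi < x < 2 * pi & dir t = dir (a + x).
Proof.
move=> /andP[a0 a1] /andP[p0 p1] /andP[t0 t1] h.
have {}h : ~~ (a <= t <= a + phi) /\ ~~ (t <= a + phi - 2 * pi).
  split; apply/negP => h'; apply: h; [left | right]; rewrite /= in_itv /=.
    by case/andP: h' => -> h'; rewrite le_min h' ltW.
  by rewrite t0.
case: h => h1; rewrite -ltNge => h2.
have [ta|ta] := lerP a t.
  exists (t - a); last by rewrite addrC subrK.
  move: h1; rewrite ta /= -ltNge => h1; apply/andP; split; lra.
exists (t + 2 * pi - a); last by rewrite (_ : a + (t + 2 * pi - a) = t + 2 * pi) ?dirD2pi //; ring.
by apply/andP; split; lra.
Qed.

Lemma dir_open_cone a phi x u v (r r' : R) : 0 < r -> 0 < r' -> 0 < x < phi -> phi < pi ->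
  u = r *: dir a -> v = r' *: dir (a + phi) -> open_cone u v (dir (a + x)).
Proof.
move=> r0 r'0 /andP[x0 x1] p1 -> ->.
have sp : 0 < sin phi by rewrite sin_gt0_pi // p1 (lt_trans x0).
have spn := gt_eqF sp.
exists (sin (phi - x) / sin phi / r), (sin x / sin phi / r'); split.
- by rewrite !divr_gt0 // sin_gt0_pi // subr_gt0 x1 /= (le_lt_trans _ p1) // gerBl ltW.
- by rewrite !divr_gt0 // sin_gt0_pi // x0 (lt_trans x1).
- have h (y : R * R) (z w : R) : 0 < w -> z / w *: (w *: y) = z *: y.
    by move=> w0; rewrite scalerA divfK // gt_eqF.
  rewrite !h //; apply: eq_coord; rewrite !coordE /= ?cosD ?sinD ?cosN ?sinN;
  by field; rewrite spn.
Qed.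

(** Membership in the cone would force sin x >= 0 and sin (phi - x) >= 0. The second fails for x <=
    pi, the first for x > pi. *)
Lemma dir_closed_cone a phi x u v (r r' : R) : 0 < r -> 0 < r' -> 0 < phi < pi ->
  u = r *: dir a -> v = r' *: dir (a + phi) -> phi < x < 2 * pi ->
  ~ closed_cone u v (dir (a + x)).
Proof.
move=> r0 r'0 /andP[p0 p1] -> -> /andP[x0 x1] [al [be [al0 be0 dE]]].
have sp : 0 < sin phi by rewrite sin_gt0_pi // p0.
have c1 : sin x = be * r' * sin phi.
  have -> : sin x = cross (dir a) (dir (a + x)) by rewrite sin_dir addrC addKr.
  rewrite dE (_ : sin phi = cross (dir a) (dir (a + phi))); last by rewrite sin_dir addrC addKr.
  by rewrite /cross !coordE; ring.
have c2 : sin (phi - x) = al * r * sin phi.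
  have -> : sin (phi - x) = cross (dir (a + x)) (dir (a + phi)).
    by rewrite sin_dir; congr sin; ring.
  rewrite dE (_ : sin phi = cross (dir a) (dir (a + phi))); last by rewrite sin_dir addrC addKr.
  by rewrite /cross !coordE; ring.
have s1 : 0 <= sin x by rewrite c1 !mulr_ge0 // ltW.
have s2 : 0 <= sin (phi - x) by rewrite c2 !mulr_ge0 // ltW.
have [xpi|xpi] := lerP x pi.
  have : 0 < sin (x - phi) by apply: sin_gt0_pi; apply/andP; split; lra.
  by rewrite -oppr_lt0 -sinN opprB ltNge s2.
have : 0 < sin (x - pi) by apply: sin_gt0_pi; apply/andP; split; lra.
rewrite -[x](subrK pi) sinDpi in s1.
by rewrite -oppr_lt0 ltNge s1.
Qed.

Lemma measurable_arc a b : measurable (arc a b).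
Proof. by apply: measurableU; exact: measurable_itv. Qed.

Lemma arc_sub a b : 0 <= a -> b <= a + 2 * pi -> a < 2 * pi -> arc a b `<=` `[0, 2 * pi[.
Proof.
move=> a0 ba a1 t [] /=; rewrite !in_itv /= ?lt_min.
  by move=> /andP[/ltW h /andP[_ ->]]; rewrite (le_trans a0).
by move=> /andP[-> h] /=; lra.
Qed.

Lemma measure_arc a b : 0 <= a < 2 * pi -> a < b -> b <= a + 2 * pi -> mu (arc a b) = (b - a)%:E.
Proof.
move=> /andP[a0 a1] ab ba.
transitivity (mu `]a, (Num.min b (2 * pi))%R[ + mu `[0%R, (b - 2 * pi)%R[)%E.
  apply: measureU; [exact: measurable_itv|exact: measurable_itv|].
  by rewrite -subset0 => t [/=]; rewrite !in_itv /= => /andP[h _] /andP[_ h']; lra.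
rewrite !lebesgue_measure_itv /= !lte_fin lt_min ab a1 /=.
have [b2|b2] := ltrP b (2 * pi).
  by rewrite subr_gt0 ltNge (ltW b2) /= adde0 -EFinB.
move: b2; rewrite le_eqVlt => /orP[/eqP <-|b2].
  by rewrite subrr ltxx adde0 -EFinB.
by rewrite subr_gt0 b2 -!EFinB -EFinD; congr EFin; ring.
Qed.

Lemma measure_closed_arc a b : 0 <= a < 2 * pi -> a < b -> (mu (closed_arc a b) <= (b - a)%:E)%E.
Proof.
move=> /andP[a0 a1] ab; apply: le_trans (lebesgue_measureU_le _ _) _.
rewrite !lebesgue_measure_itv /= !lte_fin lt_min ab a1 /=.
have [b2|b2] := ltrP b (2 * pi).
  by rewrite subr_gt0 ltNge (ltW b2) /= adde0 -EFinB.
case: ifP => _; rewrite -!EFinB ?adde0 -?EFinD lee_fin //; lra.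
Qed.

Lemma vangleC u v : vangle u v = vangle v u.
Proof. by rewrite /vangle dotC (mulrC (enorm u)). Qed.

Lemma open_coneC u v : open_cone u v `<=` open_cone v u.
Proof. by move=> d [a [b [a0 b0 ->]]]; exists b, a; rewrite addrC. Qed.

Lemma closed_coneC u v : closed_cone u v `<=` closed_cone v u.
Proof. by move=> d [a [b [a0 b0 ->]]]; exists b, a; rewrite addrC. Qed.

Lemma open_cone_arc u v : cross u v != 0 -> exists S : set R,
  [/\ measurable S, S `<=` `[0, 2 * pi[, mu S = (vangle u v)%:E &
      forall t, S t -> open_cone u v (dir t)].
Proof.
wlog c0 : u v / 0 < cross u v => [hw|_].
  rewrite neq_lt => /orP[c0|c0]; last by apply: hw => //; rewrite gt_eqF.
  have cE : cross v u = - cross u v by rewrite /cross; ring.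
  have [||S [mS S2 Sv Sc]] := hw v u; rewrite ?cE ?oppr_gt0 ?oppr_eq0 ?lt_eqF //.
  by exists S; split; rewrite // ?(vangleC u) // => t /Sc; exact: open_coneC.
have [a ab [pb uE vE]] := polar2 c0.
have r0 : 0 < enorm u by apply: enorm_gt0; apply: contraTneq c0 => ->; rewrite /cross /= !mul0r subrr ltxx.
have r'0 : 0 < enorm v by apply: enorm_gt0; apply: contraTneq c0 => ->; rewrite /cross /= !mulr0 subrr ltxx.
have [p0 p1] := andP pb; have [a0 a1] := andP ab; have pi0 := pi_gt0 R.
exists (arc a (a + vangle u v)); split.
- exact: measurable_arc.
- by apply: arc_sub => //; rewrite lerD2l; lra.
- by rewrite measure_arc ?ltrDl // ?lerD2l ?(addrC a) ?addrK //; lra.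
- by move=> t /(arcP ab pb)[x xb ->]; exact: (dir_open_cone r0 r'0 xb p1 uE vE).
Qed.

Lemma closed_cone_arc u v : cross u v != 0 -> exists2 S : set R,
  (mu S <= (vangle u v)%:E)%E &
  forall t, 0 <= t < 2 * pi -> closed_cone u v (dir t) -> S t.
Proof.
wlog c0 : u v / 0 < cross u v => [hw|_].
  rewrite neq_lt => /orP[c0|c0]; last by apply: hw => //; rewrite gt_eqF.
  have cE : cross v u = - cross u v by rewrite /cross; ring.
  have [||S Sv Sc] := hw v u; rewrite ?cE ?oppr_gt0 ?oppr_eq0 ?lt_eqF //.
  by exists S; rewrite // ?(vangleC u) // => t tb /closed_coneC; exact: Sc.
have [a ab [pb uE vE]] := polar2 c0.
have r0 : 0 < enorm u by apply: enorm_gt0; apply: contraTneq c0 => ->; rewrite /cross /= !mul0r subrr ltxx.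
have r'0 : 0 < enorm v by apply: enorm_gt0; apply: contraTneq c0 => ->; rewrite /cross /= !mulr0 subrr ltxx.
have [p0 p1] := andP pb.
exists (closed_arc a (a + vangle u v)).
  have := @measure_closed_arc a (a + vangle u v) ab; rewrite ltrDl => /(_ p0).
  by rewrite (_ : a + vangle u v - a = vangle u v) //; ring.
move=> t tb ct; apply: contrapT => /(closed_arcP ab pb tb)[x xb tE].
by apply: (dir_closed_cone r0 r'0 pb uE vE xb); rewrite -tE.
Qed.

(** Each open cone contains the directions of a measurable subset of [0, 2 pi) whose length is its
    angle. Disjoint cones make these subsets disjoint, and additivity applies. *)
Lemma packing_angles (I : finType) (A : {set I}) (u v : I -> R * R) :
  (forall i, i \in A -> cross (u i) (v i) != 0) ->
  (forall i j d, i \in A -> j \in A -> i != j ->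
     open_cone (u i) (v i) d -> open_cone (u j) (v j) d -> False) ->
  \sum_(i in A) vangle (u i) (v i) <= 2 * pi.
Proof.
move=> c0 disj.
have [S hS] : {S : I -> set R & forall i, i \in A -> [/\ measurable (S i), S i `<=` `[0, 2 * pi[,
    mu (S i) = (vangle (u i) (v i))%:E & forall t, S i t -> open_cone (u i) (v i) (dir t)]}.
  apply: (@choice _ _ (fun i S => i \in A -> [/\ measurable S, S `<=` `[0, 2 * pi[,
    mu S = (vangle (u i) (v i))%:E & forall t, S t -> open_cone (u i) (v i) (dir t)])) => i.
  case: (boolP (i \in A)) => [iA|]; last by exists set0.
  by have [S hS] := open_cone_arc (c0 i iA); exists S.
have claim (s : seq I) : uniq s -> {subset s <= A} ->
    [/\ measurable (\big[setU/set0]_(i <- s) S i),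
        mu (\big[setU/set0]_(i <- s) S i) = (\sum_(i <- s) vangle (u i) (v i))%:E &
        \big[setU/set0]_(i <- s) S i `<=` `[0, 2 * pi[].
  elim: s => [|i s IH] => [_ _|/= /andP[nis us] sA].
    by rewrite !big_nil measure0; split.
  have [mU muU sub] := IH us (fun j js => sA j (mem_behead (s := i :: s) js)).
  have [mSi Si2 muSi Sic] := hS i (sA i (mem_head _ _)).
  rewrite !big_cons; split; first exact: measurableU.
    rewrite EFinD -muSi -muU; apply: measureU => //.
    rewrite -subset0 => t [Sit]; rewrite -bigcup_seq => -[j /= js Sjt].
    have jA : j \in A by apply: sA; rewrite in_cons js orbT.
    have [_ _ _ Sjc] := hS j jA.
    apply: (disj i j (dir t)) => //; [exact: sA (mem_head _ _)| |exact: Sic|exact: Sjc].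
    by apply: contraNneq nis => ->.
  by move=> t [/Si2|/sub].
have [|mU muU sub] := claim (enum A) (enum_uniq _); first by move=> i; rewrite mem_enum.
rewrite -big_enum -lee_fin -muU; apply: le_trans (le_lebesgue_measure sub) _.
by rewrite lebesgue_measure_itv /= lte_fin twopi_gt0 sube0.
Qed.

(** Dual to [packing_angles]: the directions of a closed cone lie in a set of at most the right
    length, and subadditivity of the outer measure suffices. *)
Lemma covering_angles (I : finType) (A : {set I}) (u v : I -> R * R) :
  (forall i, i \in A -> cross (u i) (v i) != 0) ->
  (forall d, d != 0 -> exists2 i, i \in A & closed_cone (u i) (v i) d) ->
  2 * pi <= \sum_(i in A) vangle (u i) (v i).
Proof.
move=> c0 cov.
have [S hS] : {S : I -> set R & forall i, i \in A -> (mu (S i) <= (vangle (u i) (v i))%:E)%E /\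
    forall t, 0 <= t < 2 * pi -> closed_cone (u i) (v i) (dir t) -> S i t}.
  apply: (@choice _ _ (fun i S => i \in A -> (mu S <= (vangle (u i) (v i))%:E)%E /\
    forall t, 0 <= t < 2 * pi -> closed_cone (u i) (v i) (dir t) -> S t)) => i.
  case: (boolP (i \in A)) => [iA|]; last by exists set0.
  by have [S h1 h2] := closed_cone_arc (c0 i iA); exists S.
have claim (s : seq I) : {subset s <= A} ->
    (mu (\big[setU/set0]_(i <- s) S i) <= (\sum_(i <- s) vangle (u i) (v i))%:E)%E.
  elim: s => [_|i s IH sA]; first by rewrite !big_nil measure0.
  rewrite !big_cons EFinD (le_trans (lebesgue_measureU_le _ _)) //.
  rewrite leeD //; first by have [] := hS i (sA i (mem_head _ _)).
  by apply: IH => j js; apply: sA; rewrite in_cons js orbT.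
rewrite -lee_fin -big_enum; apply: le_trans (claim _ _); last by move=> i; rewrite mem_enum.
have -> : (2 * pi)%:E = mu `[0, 2 * pi[.
  by rewrite lebesgue_measure_itv /= lte_fin twopi_gt0 sube0.
apply: le_lebesgue_measure => t; rewrite /= in_itv /= -bigcup_seq => tb.
have dn : dir t != 0.
  apply/eqP => d0; have := cos2Dsin2 t.
  have [-> ->] : cos t = 0 /\ sin t = 0 by case: d0.
  by rewrite expr0n addr0 => /eqP; rewrite eq_sym oner_eq0.
have [i iA ct] := cov _ dn.
by exists i; rewrite /= ?mem_enum //; have [_] := hS i iA; apply.
Qed.
End CircleMeasure.

(** * Corners of strictly convex pentagons *)

Section Corners.
Variable R : realType.
Implicit Types (P Q : polygon5 R) (x d : R * R) (s : R).

Definition corner_left P (i : 'I_5) : R * R := P (ordS i) - P i.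
Definition corner_right P (i : 'I_5) : R * R := P (ord_pred i) - P i.
Definition corner_angle P i : R := vangle (corner_left P i) (corner_right P i).
Definition corner_cone P i : set (R * R) := open_cone (corner_left P i) (corner_right P i).
Definition corner_closed_cone P i : set (R * R) :=
  closed_cone (corner_left P i) (corner_right P i).

Lemma vangleN u v : u != 0 -> v != 0 -> vangle u (- v) = pi - vangle u v :> R.
Proof.
move=> u0 v0; rewrite /vangle enormN -acosN ?cos_vangle_bound //; congr acos.
by rewrite -mulNr; congr (_ / _); rewrite /dot !coordE; ring.
Qed.

Lemma ord_pred5K (i : 'I_5) : ordS (ord_pred i) = i.
Proof. by rewrite ord_pred5E ordS5K. Qed.

Lemma strictly_convex_neq0 P s : strictly_convex P s -> s != 0.
Proof.
by move=> cP; apply: contraTneq (strictly_convex_turn 0 cP) => ->; rewrite mul0r ltxx.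
Qed.

Lemma strictly_convex_edge P s i : strictly_convex P s -> corner_left P i != 0.
Proof.
move=> cP; apply: contraTneq (strictly_convex_turn i cP); rewrite /corner_left => ->.
by rewrite /cross /= !mul0r subrr mulr0 ltxx.
Qed.

Lemma corner_rightE P i : corner_right P i = - corner_left P (ord_pred i).
Proof. by rewrite /corner_right /corner_left ord_pred5K opprB. Qed.

Lemma strictly_convex_pred P s i : strictly_convex P s ->
  0 < s * cross (corner_left P (ord_pred i)) (corner_left P i).
Proof. by move=> cP; have := strictly_convex_turn (ord_pred i) cP; rewrite /corner_left !ord_pred5K. Qed.

Lemma corner_cross P s i : strictly_convex P s -> 0 < s * cross (corner_left P i) (corner_right P i).
Proof.
move=> cP; have := strictly_convex_pred i cP; rewrite corner_rightE; congr (_ < _).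
by rewrite /cross !coordE; ring.
Qed.

Lemma corner_cross_neq0 P s i : strictly_convex P s -> cross (corner_left P i) (corner_right P i) != 0.
Proof. by move=> cP; apply: contraTneq (corner_cross i cP) => ->; rewrite mulr0 ltxx. Qed.

(* A direction d in the exterior cone at P i makes P i the unique minimum of
   cross d over the vertices, so the exterior cones tile the circle. *)
Lemma exterior_cone_min P s d (i j : 'I_5) : strictly_convex P s -> j != i ->
  open_cone (corner_left P (ord_pred i)) (corner_left P i) d ->
  0 < s * cross d (P j - P i).
Proof.
move=> cP ji [a [b [a0 b0 ->]]].
have -> : s * cross (a *: corner_left P (ord_pred i) + b *: corner_left P i) (P j - P i)
    = a * side P s (ord_pred i) (P j) + b * side P s i (P j).
  by rewrite /side /corner_left ord_pred5K /cross !coordE; ring.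
have h1 := side_ge0 i j cP; have h2 := side_ge0 (ord_pred i) j cP.
have [jSi|jSi] := eqVneq j (ordS i); last first.
  by apply: ltr_wpDl; [apply: mulr_ge0 => //; exact: ltW | apply: mulr_gt0 => //; exact: cP].
apply: ltr_pwDl; [apply: mulr_gt0 => //; apply: cP; rewrite ?ord_pred5K // | by apply: mulr_ge0 => //; exact: ltW].
by rewrite jSi ord_pred5E eq_sym; have [_ _ -> _] := ordS5_neq (ordS i).
Qed.

Lemma sum_exterior_angles P s : strictly_convex P s ->
  \sum_i vangle (corner_left P (ord_pred i)) (corner_left P i) = 2 * pi.
Proof.
move=> cP.
have c0 (i : 'I_5) : cross (corner_left P (ord_pred i)) (corner_left P i) != 0.
  by apply: contraTneq (strictly_convex_pred i cP) => ->; rewrite mulr0 ltxx.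
pose u (i : 'I_5) := corner_left P (ord_pred i).
pose v (i : 'I_5) := corner_left P i.
rewrite (_ : \sum_i _ = \sum_(i in [set: 'I_5]%SET) vangle (u i) (v i)); last first.
  by apply: eq_bigl => i; rewrite finset.in_setT.
apply/eqP; rewrite eq_le; apply/andP; split.
  apply: packing_angles => [i _|i j d _ _ ij di dj]; first exact: c0.
  have h1 := exterior_cone_min cP ij dj.
  have ji : j != i by rewrite eq_sym.
  have := exterior_cone_min cP ji di.
  rewrite (_ : cross d (P j - P i) = - cross d (P i - P j)); last by rewrite /cross !coordE; ring.
  by rewrite mulrN oppr_gt0 ltNge ltW.
apply: covering_angles => [i _|d _]; first exact: c0.
(* Conversely, a vertex minimizing [s * cross d] has [d] in its closed exterior cone; the
   coefficients come from Cramer's rule. *)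
case: (arg_minP (fun i : 'I_5 => s * cross d (P i)) (i0 := 0) (P := predT) isT) => i _ imin.
exists i; first by rewrite finset.in_setT.
have s0 := strictly_convex_neq0 cP.
have D0 := strictly_convex_pred i cP.
have m1 : 0 <= s * cross d (corner_left P i).
  have := imin (ordS i) isT; rewrite -subr_ge0; congr (_ <= _).
  by rewrite /corner_left /cross !coordE; ring.
have m2 : 0 <= s * cross (corner_left P (ord_pred i)) d.
  have := imin (ord_pred i) isT; rewrite -subr_ge0; congr (_ <= _).
  by rewrite /corner_left ord_pred5K /cross !coordE; ring.
exists (s * cross d (corner_left P i) / (s * cross (corner_left P (ord_pred i)) (corner_left P i))),
  (s * cross (corner_left P (ord_pred i)) d / (s * cross (corner_left P (ord_pred i)) (corner_left P i))).
split; rewrite ?divr_ge0 // ?(ltW D0) //.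
have := c0 i; rewrite /u /v; move: (corner_left P _) (corner_left P i) => e f.
rewrite /cross => e0.
by apply: eq_coord; rewrite !coordE /=; field; rewrite s0 e0.
Qed.

Lemma sum_corner_angles P s : strictly_convex P s -> \sum_i corner_angle P i = 3 * pi.
Proof.
move=> cP.
under eq_bigr => i _.
  rewrite /corner_angle corner_rightE vangleN ?(strictly_convex_edge _ cP) // vangleC.
  over.
rewrite big_split /= sumrN (sum_exterior_angles cP) sumr_const card_ord; ring.
Qed.

Lemma cos_pi5 : 309 / 1000 <= cos (2 * (pi / 5)) :> R.
Proof.
set x : R := pi / 5; set c := cos x.
have pi0 := pi_gt0 R.
have c0 : 0 < c by apply: cos_gt0_pihalf; rewrite /x; apply/andP; split; lra.
have c2 : cos (2 * x) = 2 * c ^+ 2 - 1 by rewrite mulr_natl cos_mulr2n mulr_natl.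
have c3 : cos (3 * x) = 4 * c ^+ 3 - 3 * c.
  rewrite (_ : 3 * x = 2 * x + x); last by ring.
  rewrite cosD c2 (_ : sin (2 * x) = 2 * (c * sin x)); last by rewrite mulr_natl sin_mulr2n mulr_natl.
  transitivity ((2 * c ^+ 2 - 1) * c - 2 * c * (sin x ^+ 2)); first by rewrite -/c; ring.
  by rewrite sin2cos2 -/c; ring.
have h : cos (3 * x) = - cos (2 * x).
  have -> : 3 * x = - (2 * x) + pi by rewrite /x; field.
  by rewrite cosDpi cosN.
(* Since 5 x = pi, cos (3 x) + cos (2 x) = 0; as a polynomial in [c] this is [c + 1] times the
   quadratic. *)
have q : 4 * c ^+ 2 - 2 * c - 1 = 0.
  have cn : c + 1 != 0 by rewrite gt_eqF // addr_gt0.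
  apply: (mulfI cn); rewrite mulr0.
  transitivity (4 * c ^+ 3 - 3 * c + (2 * c ^+ 2 - 1)); first by ring.
  by rewrite -c3 -c2 h addNr.
have cl : 809 / 1000 <= c.
  rewrite leNgt; apply/negP => cl.
  have : c * c < c * (809 / 1000) by rewrite ltr_pM2l.
  by clear -q c0 cl; nra.
(* By [q], 2 c^2 - 1 = c - 1/2, so 809/1000 yields exactly 309/1000. *)
by rewrite c2; lra.
Qed.

Lemma corner_angle_gt P s i : strictly_convex P s ->
  corner_cos P i < 61 / 200 -> 2 * pi / 5 < corner_angle P i.
Proof.
move=> cP hcos.
have u0 := strictly_convex_edge i cP.
have v0 : corner_right P i != 0 by rewrite corner_rightE oppr_eq0 (strictly_convex_edge _ cP).
have cb := cos_vangle_bound u0 v0.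
have pi0 := pi_gt0 R.
rewrite /corner_angle /vangle -ltr_cos.
- rewrite acosK; last by rewrite in_itv.
  by rewrite -mulrA; apply: lt_le_trans cos_pi5; apply: lt_trans hcos _; lra.
- by rewrite in_itv /=; apply/andP; split; lra.
- by rewrite in_itv /= acos_ge0 ?acos_lepi.
Qed.

(** The side functions of the two edges at [P i] vanish there and increase along [d]; the other
    three are positive at [P i] and stay so for a small step. *)
Lemma corner_cone_near P s i d : strictly_convex P s -> corner_cone P i d ->
  \forall e \near 0^'+, (region P)° (P i + e *: d).
Proof.
move=> cP [a [b [a0 b0 dE]]].
suff : \forall e \near 0^'+, forall j, 0 < side P s j (P i + e *: d).
  by apply: filterS => e; exact: side_gt0_interior.
apply: (@filter_forall _ _ (fun j => [set e | 0 < side P s j (P i + e *: d)]) (0^'+)) => j.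
have sE e : side P s j (P i + e *: d) = side P s j (P i) + e * (s * cross (corner_left P j) d).
  by rewrite /side /corner_left /cross !coordE; ring.
have zero : 0 < s * cross (corner_left P j) d -> side P s j (P i) = 0 ->
    \forall e \near 0^'+, 0 < side P s j (P i + e *: d).
  move=> h h0; near=> e; rewrite sE h0 add0r mulr_gt0 //.
have [ij|ij] := eqVneq i j.
  apply: zero; last by rewrite ij side_id.
  rewrite -ij dE (_ : s * _ = b * (s * cross (corner_left P i) (corner_right P i))).
    by rewrite mulr_gt0 // corner_cross.
  by rewrite /cross !coordE; ring.
have [iSj|iSj] := eqVneq i (ordS j).
  apply: zero; last by rewrite iSj side_ordS.
  have jE : j = ord_pred i by apply: ordS5_inj; rewrite ord_pred5K.
  rewrite jE dE corner_rightE (_ : s * _ = a * (s * cross (corner_left P (ord_pred i)) (corner_left P i))).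
    by rewrite mulr_gt0 // strictly_convex_pred.
  by rewrite /cross !coordE; ring.
have A0 := cP j i ij iSj.
set B := s * cross _ d in sE.
have B1 : 0 < `|B| + 1 by rewrite ltr_wpDl.
near=> e; rewrite /= sE.
have e0 : 0 < e by [].
have : e * (`|B| + 1) < side P s j (P i).
  by rewrite -ltr_pdivlMr //; near: e; apply: nbhs_right_lt; rewrite divr_gt0.
have : - (e * B) <= e * `|B| by rewrite -mulrN ler_wpM2l ?(ltW e0) // -normrN ler_norm.
by rewrite mulrDr mulr1; lra.
Unshelve. all: by end_near.
Qed.

Lemma corner_cones_disjoint P Q s s' i j d : strictly_convex P s -> strictly_convex Q s' ->
  P i = Q j -> (region P)° `&` (region Q)° = set0 ->
  corner_cone P i d -> corner_cone Q j d -> False.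
Proof.
move=> cP cQ PQ disj dP dQ.
have hP := corner_cone_near cP dP; have hQ := corner_cone_near cQ dQ.
have [e [h1 h2]] := filter_ex (filterI hP hQ).
suff : (region P)° `&` (region Q)° !=set0 by rewrite disj => -[].
by exists (P i + e *: d); split => //; rewrite PQ.
Qed.

Lemma region_corner_closed_cone P s i d e : strictly_convex P s -> 0 < e ->
  region P (P i + e *: d) -> corner_closed_cone P i d.
Proof.
move=> cP e0 rP.
have s0 := strictly_convex_neq0 cP.
have c0 := corner_cross_neq0 i cP; have D0 := corner_cross i cP.
have m1 : 0 <= s * cross (corner_left P i) d.
  have := region_side i cP rP; rewrite (_ : side _ _ _ _ = e * (s * cross (corner_left P i) d)).
    by rewrite pmulr_rge0.
  by rewrite /side /corner_left /cross !coordE; ring.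
have m2 : 0 <= s * cross d (corner_right P i).
  have := region_side (ord_pred i) cP rP; rewrite (_ : side _ _ _ _ = e * (s * cross d (corner_right P i))).
    by rewrite pmulr_rge0.
  by rewrite /side /corner_right ord_pred5K /cross !coordE; ring.
exists (s * cross d (corner_right P i) / (s * cross (corner_left P i) (corner_right P i))),
  (s * cross (corner_left P i) d / (s * cross (corner_left P i) (corner_right P i))).
split; rewrite ?divr_ge0 // ?(ltW D0) //.
move: c0; move: (corner_left P i) (corner_right P i) => u v; rewrite /cross => c0.
by apply: eq_coord; rewrite !coordE /=; field; rewrite s0 c0.
Qed.
End Corners.

(** * Tiles around a vertex *)

Section Congruence.
Variable R : realType.
Implicit Types (P Q : polygon5 R) (x y v : R * R).

Lemma polarization u v w : dot (u - w) (v - w) =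
  (enorm (u - w) ^+ 2 + enorm (v - w) ^+ 2 - enorm (u - v) ^+ 2) / 2 :> R.
Proof. by rewrite !sqr_enorm /dot !coordE; field. Qed.

Lemma congruent_enorm P Q i j : congruent P Q -> enorm (Q i - Q j) = enorm (P i - P j).
Proof. by move=> [f isof fE]; rewrite !fE isof. Qed.

Lemma congruent_dot P Q i j k : congruent P Q ->
  dot (Q i - Q k) (Q j - Q k) = dot (P i - P k) (P j - P k).
Proof. by move=> PQ; rewrite !polarization !(congruent_enorm _ _ PQ). Qed.

Lemma congruent_corner_cos P Q i : congruent P Q -> corner_cos Q i = corner_cos P i.
Proof. by move=> PQ; rewrite /corner_cos (congruent_dot _ _ _ PQ) !(congruent_enorm _ _ PQ). Qed.

Lemma dot_sum (I J : finType) (a : I -> R) (b : J -> R) (u : I -> R * R) (v : J -> R * R) :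
  dot (\sum_i a i *: u i) (\sum_j b j *: v j) = \sum_i \sum_j a i * b j * dot (u i) (v j).
Proof.
have fstE (K : finType) (c : K -> R) (w : K -> R * R) : (\sum_k c k *: w k).1 = \sum_k c k * (w k).1.
  by rewrite (big_morph (fun u : R * R => u.1) (id1 := 0) (op1 := +%R)).
have sndE (K : finType) (c : K -> R) (w : K -> R * R) : (\sum_k c k *: w k).2 = \sum_k c k * (w k).2.
  by rewrite (big_morph (fun u : R * R => u.2) (id1 := 0) (op1 := +%R)).
rewrite /dot !fstE !sndE !mulr_suml -big_split /=; apply: eq_bigr => i _.
rewrite !mulr_sumr -big_split /=; apply: eq_bigr => j _; ring.
Qed.

(** An [isometry] is not assumed affine, so convex combinations are transported through scalar
    products: the squared length of the weighted sum of the [Q j - Q i] depends only on distances,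
    and it is zero. *)
Lemma congruent_subhull P Q i : congruent P Q -> subhull Q i (Q i) -> subhull P i (P i).
Proof.
move=> PQ [l [l0 li l1 QE]]; exists l; split => //.
have shift (S : polygon5 R) : \sum_j l j *: (S j - S i) = \sum_j l j *: S j - S i.
  under eq_bigr do rewrite scalerBr.
  by rewrite big_split /= sumrN -scaler_suml l1 scale1r.
have : dot (\sum_j l j *: (P j - P i)) (\sum_j l j *: (P j - P i)) = 0.
  transitivity (dot (\sum_j l j *: (Q j - Q i)) (\sum_j l j *: (Q j - Q i))).
    rewrite !dot_sum; apply: eq_bigr => j _; apply: eq_bigr => k _.
    by rewrite (congruent_dot _ _ _ PQ).
  by rewrite shift -QE subrr /dot /= !mulr0 addr0.
rewrite shift -sqr_enorm => /eqP; rewrite sqrf_eq0 enorm_eq0 subr_eq0 => /eqP ->//.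
Qed.

Lemma congruent_trans P P' Q : congruent P P' -> congruent P' Q -> congruent P Q.
Proof.
move=> [f isof fE] [g isog gE]; exists (g \o f) => [x y|i] /=; first by rewrite isog isof.
by rewrite gE fE.
Qed.

Lemma congruent_translate P v : congruent P (fun i => P i + v).
Proof.
exists (fun x => x + v) => // x y; congr enorm.
by apply: eq_coord; rewrite !coordE; ring.
Qed.

Lemma simple_translate P v : simple_pentagon P -> simple_pentagon (fun i => P i + v).
Proof.
move=> [injP sP]; split => [i j /addIr /injP //|i j x ij].
have edgeE k : edge (fun i => P i + v) k x -> edge P k (x - v).
  move=> [t t01 ->]; exists t => //; apply: eq_coord; rewrite !coordE; ring.
move=> /edgeE hi /edgeE hj; have [[-> h]|[-> h]] := sP i j _ ij hi hj; [left|right]; split => //.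
  by rewrite -h subrK.
by rewrite -h subrK.
Qed.

(** Convexity of the copy is rederived from its own simplicity and from [congruent_subhull], so no
    area has to be transported. *)
Lemma congruent_efficient_convex E Q : efficient E -> congruent E Q -> simple_pentagon Q ->
  exists s, strictly_convex Q s.
Proof.
move=> eE EQ sQ; have [i /(congruent_subhull EQ)|s _ cQ] := simple_strictly_convex sQ.
  exact: efficient_not_subhull.
by exists s.
Qed.

Lemma congruent_efficient_angle E Q i : efficient E -> congruent E Q -> simple_pentagon Q ->
  2 * pi / 5 < corner_angle Q i.
Proof.
move=> eE EQ sQ; have [s cQ] := congruent_efficient_convex eE EQ sQ.
apply: (corner_angle_gt cQ); rewrite (congruent_corner_cos _ EQ); exact: efficient_corner_cos.
Qed.
End Congruence.

(** * Lattice translates, edge-to-edge contacts and local finiteness *)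

Section Tiling.
Variables (R : realType) (T : finType) (D : torus_tiling R T).
Hypothesis hedge : edge_to_edge D.
Implicit Types (k l : T * int * int) (x d : R * R) (c : T * 'I_5).

Definition lattice_vector (a b : int) : R * R := lat1 D *~ a + lat2 D *~ b.

Lemma lifted_tileE k i : lifted_tile D k i = tile D k.1.1 i + lattice_vector k.1.2 k.2.
Proof. by rewrite /lifted_tile /translate -addrA. Qed.

Lemma lifted_tile_fun k : lifted_tile D k = (fun i => tile D k.1.1 i + lattice_vector k.1.2 k.2).
Proof. by apply/funext => i; rewrite lifted_tileE. Qed.

Lemma lifted_simple k : simple_pentagon (lifted_tile D k).
Proof. rewrite lifted_tile_fun; apply: simple_translate; exact: tile_simple. Qed.

Lemma lifted_congruent E k : congruent E (tile D k.1.1) -> congruent E (lifted_tile D k).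
Proof. by move=> h; rewrite lifted_tile_fun; apply: congruent_trans h _; exact: congruent_translate. Qed.

Lemma lifted_left k i : corner_left (lifted_tile D k) i = corner_left (tile D k.1.1) i.
Proof. by rewrite /corner_left !lifted_tileE; apply: eq_coord; rewrite !coordE; ring. Qed.

Lemma lifted_right k i : corner_right (lifted_tile D k) i = corner_right (tile D k.1.1) i.
Proof. by rewrite /corner_right !lifted_tileE; apply: eq_coord; rewrite !coordE; ring. Qed.

Lemma lattice_vectorD a b a' b' :
  lattice_vector (a + a') (b + b') = lattice_vector a b + lattice_vector a' b'.
Proof. by rewrite /lattice_vector !mulrzDr addrACA. Qed.

Lemma lattice_vectorN a b : lattice_vector (- a) (- b) = - lattice_vector a b.
Proof. by rewrite /lattice_vector !mulrNz opprD. Qed.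

Lemma lattice_vector_cross a b :
  (cross (lattice_vector a b) (lat2 D) = a%:~R * cross (lat1 D) (lat2 D)) /\
  (cross (lat1 D) (lattice_vector a b) = b%:~R * cross (lat1 D) (lat2 D)).
Proof.
have fz (u : R * R) (z : int) : u *~ z = z%:~R *: u by rewrite scaler_int.
by rewrite /lattice_vector !fz /cross !coordE; split; ring.
Qed.

Lemma lattice_vector_inj a b a' b' : lattice_vector a b = lattice_vector a' b' ->
  a = a' /\ b = b'.
Proof.
move=> h; have [e1 e2] := lattice_vector_cross a b; have [e1' e2'] := lattice_vector_cross a' b'.
have c0 := lattice_rank2 D; split.
  by apply: (@intr_inj R); apply: (mulIf c0); rewrite -e1 -e1' h.
by apply: (@intr_inj R); apply: (mulIf c0); rewrite -e2 -e2' h.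
Qed.

Lemma segment_extreme (p q x y z : R * R) (t : R) : 0 < t < 1 -> x = y + t *: (z - y) ->
  segment p q y -> segment p q z -> x = p -> y = z.
Proof.
move=> /andP[t0 t1] xE [a /andP[a0 a1] yE] [b /andP[b0 b1] zE] xp.
have [pq|pq] := eqVneq q p; first by rewrite yE zE pq subrr !scaler0.
have h : ((1 - t) * a + t * b) *: (q - p) = 0.
  apply: (addrI p); rewrite addr0 -[in RHS]xp xE yE zE.
  by apply: eq_coord; rewrite !coordE; ring.
have : (1 - t) * a + t * b == 0.
  by have := h => /eqP; rewrite scaler_eq0 subr_eq0 (negbTE pq) orbF.
rewrite paddr_eq0 ?mulr_ge0 ?subr_ge0 ?(ltW t1) ?(ltW t0) // !mulf_eq0.
rewrite subr_eq0 (gt_eqF t1) (gt_eqF t0) /= => /andP[/eqP a00 /eqP b00].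
by rewrite yE zE a00 b00.
Qed.

Lemma segment_sym (p q : R * R) : segment p q `<=` segment q p.
Proof.
move=> x [t /andP[t0 t1] ->]; exists (1 - t).
  by rewrite subr_ge0 t1 gerBl t0.
by apply: eq_coord; rewrite !coordE; ring.
Qed.

(** A contact along a common edge could a priori put a vertex of one tile inside an edge of the
    other. But equal segments have the same extreme points, so an endpoint for [l] is one for
    [k]. *)
Lemma vertex_of_region k l i : region (lifted_tile D k) (lifted_tile D l i) ->
  exists j, lifted_tile D k j = lifted_tile D l i.
Proof.
move=> rk; have [->|kl] := pselect (k = l); first by exists i.
set x := lifted_tile D l i in rk *.
have rl : region (lifted_tile D l) x by left; exists i => //; exact: segment_left.
have [[j [_ [-> _]]]|[j [j' [jx eE]]]] := hedge kl rk rl; first by exists j.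
have [injl sl] := lifted_simple l.
have xl : edge (lifted_tile D l) j' x by rewrite -eE.
(* A vertex on an edge of its own simple pentagon is an endpoint of that edge. *)
have xend : x = lifted_tile D l j' \/ x = lifted_tile D l (ordS j').
  have [->|ij] := eqVneq j' i; first by left.
  have := sl i j' x; rewrite eq_sym => /(_ ij (segment_left _ _) xl) [[_ ->]|[iE _]]; first by left.
  by right; rewrite -iE.
case: jx => t /andP[t0 t1] xE.
have [t00|tn0] := eqVneq t 0; first by exists j; rewrite xE t00 scale0r addr0.
have [t11|tn1] := eqVneq t 1.
  by exists (ordS j); rewrite xE t11 scale1r addrC subrK.
have t01 : 0 < t < 1 by rewrite !lt_neqAle t0 t1 tn1 eq_sym tn0.
have inl y : edge (lifted_tile D k) j y -> edge (lifted_tile D l) j' y by rewrite eE.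
have h1 := inl _ (segment_left _ _); have h2 := inl _ (segment_right _ _).
have inj1 : lifted_tile D k j <> lifted_tile D k (ordS j).
  move=> /(lifted_simple k).1 /eqP; rewrite eq_sym; have [n1 _ _ _] := ordS5_neq j.
  by rewrite (negbTE n1).
case: xend => xend; exfalso; apply: inj1.
  exact: (segment_extreme t01 xE h1 h2 xend).
exact: (segment_extreme t01 xE (segment_sym h1) (segment_sym h2) xend).
Qed.

(** A translate meeting the box of half-width [M] has a lattice vector with coordinates at most
    [M + B], where [B] bounds all tile coordinates. Cramer's rule, [lattice_vector_cross], turns
    this into the bound [K] on both integer coefficients. *)
Lemma locally_finite (M : R) : exists F : seq (T * int * int), forall k y,
  `|y.1| <= M -> `|y.2| <= M -> region (lifted_tile D k) y -> k \in F.
Proof.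
pose B := \sum_(t : T) \sum_i (`|(tile D t i).1| + `|(tile D t i).2|).
have hB t i : `|(tile D t i).1| + `|(tile D t i).2| <= B.
  rewrite /B (bigD1 t) //= (bigD1 i) //= -addrA lerDl addr_ge0 //.
    by apply: sumr_ge0 => j _; rewrite addr_ge0.
  by apply: sumr_ge0 => s _; apply: sumr_ge0 => j _; rewrite addr_ge0.
pose L := `|(lat1 D).1| + `|(lat1 D).2| + `|(lat2 D).1| + `|(lat2 D).2|.
pose K := (M + B) * L / `|cross (lat1 D) (lat2 D)|.
pose ints := [seq Posz n | n <- iota 0 (Num.truncn K).+1] ++
  [seq - Posz n | n <- iota 0 (Num.truncn K).+1].
have mem_ints (z : int) : `|z%:~R| <= K -> z \in ints.
  move=> zK; have K0 := le_trans (normr_ge0 _) zK.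
  have {zK} : (`|z|%N <= Num.truncn K)%N by rewrite truncn_ge_nat // natr_absz intr_norm.
  rewrite mem_cat; case: z => n zN; apply/orP; [left|right]; apply/mapP.
    by exists n => //; rewrite mem_iota /= add0n ltnS.
  by exists n.+1; rewrite ?NegzE // mem_iota /= add0n ltnS.
exists [seq (p, b) | p <- [seq (t, a) | t <- enum T, a <- ints], b <- ints] => -[[t a] b] y y1 y2 ry.
have box : `|(y - lattice_vector a b).1| <= B /\ `|(y - lattice_vector a b).2| <= B.
  apply: (region_sub_convex (P := lifted_tile D (t, a, b)) (H := [set z | `|(z - lattice_vector a b).1| <= B /\ `|(z - lattice_vector a b).2| <= B])) ry.
    move=> p q [p1 p2] [q1 q2] z [s /andP[s0 s1] ->] /=.
    have conv (e f g : R) : `|e - g| <= B -> `|f - g| <= B -> `|e + s * (f - e) - g| <= B.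
      move=> he hf; rewrite (_ : _ - g = (1 - s) * (e - g) + s * (f - g)); last by ring.
      apply: le_trans (ler_normD _ _) _; rewrite !normrM (ger0_norm s0) ger0_norm ?subr_ge0 //.
      have h1 : (1 - s) * `|e - g| <= (1 - s) * B by rewrite ler_wpM2l // subr_ge0.
      have h2 : s * `|f - g| <= s * B by rewrite ler_wpM2l.
      by lra.
    by split; apply: conv.
  move=> i; rewrite lifted_tileE /mkset addrK; have := hB t i.
  have := normr_ge0 (tile D t i).1; have := normr_ge0 (tile D t i).2.
  by move=> *; split; lra.
have [h1 h2] : `|(lattice_vector a b).1| <= M + B /\ `|(lattice_vector a b).2| <= M + B.
  case: box => b1 b2; split.
    rewrite (_ : (lattice_vector a b).1 = y.1 - (y - lattice_vector a b).1); last by rewrite !coordE; ring.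
    by apply: le_trans (ler_normB _ _) _; exact: lerD.
  rewrite (_ : (lattice_vector a b).2 = y.2 - (y - lattice_vector a b).2); last by rewrite !coordE; ring.
  by apply: le_trans (ler_normB _ _) _; exact: lerD.
have MB : 0 <= M + B by rewrite (le_trans _ h1).
have c0 : 0 < `|cross (lat1 D) (lat2 D)| by rewrite normr_gt0; exact: lattice_rank2.
have crossb (u v : R * R) (A : R) : `|u.1| * `|v.2| + `|u.2| * `|v.1| <= A -> `|cross u v| <= A.
  by apply: le_trans; rewrite /cross -!normrM; exact: ler_normB.
have [ca cb] := lattice_vector_cross a b.
apply: (allpairs_f pair).
  apply: (allpairs_f pair); first by rewrite mem_enum.
  apply: mem_ints; rewrite /K ler_pdivlMr // -normrM -ca; apply: crossb.
  have H1 : `|(lattice_vector a b).1| * `|(lat2 D).2| <= (M + B) * `|(lat2 D).2| by rewrite ler_wpM2r.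
  have H2 : `|(lattice_vector a b).2| * `|(lat2 D).1| <= (M + B) * `|(lat2 D).1| by rewrite ler_wpM2r.
  apply: le_trans (lerD H1 H2) _; rewrite -mulrDr ler_wpM2l // /L.
  have := normr_ge0 (lat1 D).1; have := normr_ge0 (lat1 D).2; lra.
apply: mem_ints; rewrite /K ler_pdivlMr // -normrM -cb; apply: crossb.
have H1 : `|(lat1 D).1| * `|(lattice_vector a b).2| <= `|(lat1 D).1| * (M + B) by rewrite ler_wpM2l.
have H2 : `|(lat1 D).2| * `|(lattice_vector a b).1| <= `|(lat1 D).2| * (M + B) by rewrite ler_wpM2l.
apply: le_trans (lerD H1 H2) _; rewrite -mulrDl mulrC ler_wpM2l // /L.
have := normr_ge0 (lat2 D).1; have := normr_ge0 (lat2 D).2; lra.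
Qed.

(** Regions are closed and only finitely many come near [x], so a short step along [d] leaves behind
    every tile that does not contain [x]. *)
Lemma near_region x d : \forall e \near 0^'+, forall k,
  region (lifted_tile D k) (x + e *: d) -> region (lifted_tile D k) x.
Proof.
have [F hF] := locally_finite (`|x.1| + `|x.2| + `|d.1| + `|d.2|).
have near_seq (s : seq (T * int * int)) : \forall e \near 0^'+, forall k, k \in s ->
    region (lifted_tile D k) (x + e *: d) -> region (lifted_tile D k) x.
  elim: s => [|k s IH]; first by near=> e.
  have hk : \forall e \near 0^'+, region (lifted_tile D k) (x + e *: d) -> region (lifted_tile D k) x.
    have [rx|nrx] := pselect (region (lifted_tile D k) x); first by near=> e.
    have oc : open (~` region (lifted_tile D k)) by rewrite openC; exact: closed_region.
    have nx : nbhs x (~` region (lifted_tile D k)) by exact: open_nbhs_nbhs.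
    have cv : (fun e : R => x + e *: d) @ 0^'+ --> x.
      rewrite -[X in _ --> X](addr0 x) -[X in _ --> x + X](scale0r d).
      exact: (cvg_at_right_filter (@line_continuous R x d 0)).
    have hn : \forall e \near 0^'+, (~` region (lifted_tile D k)) (x + e *: d) by exact: cv nx.
    by apply: filterS hn => e h1 h2.
  by near=> e => l; rewrite in_cons => /orP[/eqP ->|ls]; [near: e | move: l ls; near: e].
near=> e => k rk.
have e0 : 0 < e by [].
have e1 : e < 1 by near: e; exact: nbhs_right_lt.
have norm_le (a b : R) : `|a + e * b| <= `|a| + `|b|.
  by rewrite (le_trans (ler_normD _ _)) // lerD2l normrM (gtr0_norm e0) ler_piMl // ltW.
have kF : k \in F.
  have := normr_ge0 x.1; have := normr_ge0 x.2; have := normr_ge0 d.1; have := normr_ge0 d.2 => *.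
  by apply: (hF k _ _ _ rk); rewrite !coordE (le_trans (norm_le _ _)) //; lra.
by move: k kF rk; near: e; exact: near_seq.
Unshelve. all: by end_near.
Qed.

End Tiling.

(** * Counting corners *)

Section Counting.
Variables (R : realType) (T : finType) (D : torus_tiling R T) (E : polygon5 R).
Hypotheses (hE : efficient E) (hedge : edge_to_edge D).
Implicit Types (k l : T * int * int) (x d : R * R) (c : T * 'I_5).

Definition corner_point c : R * R := tile D c.1 c.2.

Definition same_vertex c c' : Prop :=
  exists a b : int, tile D c'.1 c'.2 + lattice_vector D a b = tile D c.1 c.2.

(** A vertex of the torus as a finite set of corners. One tile may contribute several corners; they
    lift to different translates, each with a single corner at [corner_point c]. *)
Definition vertex_class c : {set T * 'I_5} := [set c' | `[< same_vertex c c' >]]%SET.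

Definition tile_efficient (t : T) : Prop := congruent E (tile D t).

Definition efficient_corners : {set T * 'I_5} := [set c | `[< tile_efficient c.1 >]]%SET.

Definition weight c : R := corner_angle (tile D c.1) c.2.

Lemma same_vertexP c c' : reflect (same_vertex c c') (c' \in vertex_class c).
Proof. by rewrite finset.inE; exact: asboolP. Qed.

Lemma vertex_class_refl c : c \in vertex_class c.
Proof. by apply/same_vertexP; exists 0, 0; rewrite /lattice_vector !mulr0z !addr0. Qed.

Lemma vertex_class_eq c c' : c' \in vertex_class c -> vertex_class c' = vertex_class c.
Proof.
move=> /same_vertexP[a [b e]]; apply/setP => c2; apply/same_vertexP/same_vertexP => -[a' [b' e']].
  by exists (a' + a), (b' + b); rewrite lattice_vectorD addrA e' e.
by exists (a' - a), (b' - b); rewrite lattice_vectorD addrA e' lattice_vectorN -e addrK.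
Qed.

Lemma vertex_class_lift c c' : c' \in vertex_class c ->
  exists ab : int * int, lifted_tile D (c'.1, ab.1, ab.2) c'.2 = corner_point c.
Proof. by move=> /same_vertexP[a [b e]]; exists (a, b); rewrite lifted_tileE. Qed.

Lemma lift_vertex_class c k i : lifted_tile D k i = corner_point c -> (k.1.1, i) \in vertex_class c.
Proof. by rewrite lifted_tileE => e; apply/same_vertexP; exists k.1.2, k.2. Qed.

Lemma tile_convex t : tile_efficient t -> exists s, strictly_convex (tile D t) s.
Proof. by move=> et; apply: (congruent_efficient_convex hE et); exact: tile_simple. Qed.

Lemma lifted_convex k : tile_efficient k.1.1 -> exists s, strictly_convex (lifted_tile D k) s.
Proof.
move=> et; apply: (congruent_efficient_convex hE (lifted_congruent et)); exact: lifted_simple.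
Qed.

Lemma weight_gt c : c \in efficient_corners -> 2 * pi / 5 < weight c.
Proof.
rewrite finset.inE => /asboolP et.
apply: (congruent_efficient_angle _ hE et); exact: tile_simple.
Qed.

Lemma sum_weight t : tile_efficient t -> \sum_i weight (t, i) = 3 * pi.
Proof. by move=> /tile_convex[s cP]; exact: sum_corner_angles cP. Qed.

Lemma weight_packing c : \sum_(c' in vertex_class c :&: efficient_corners) weight c' <= 2 * pi.
Proof.
apply: packing_angles => [c'|c1 c2 d].
  rewrite finset.inE => /andP[_]; rewrite finset.inE => /asboolP /tile_convex[s].
  exact: corner_cross_neq0.
rewrite !finset.in_setI => /andP[/vertex_class_lift[[a1 b1] e1]]; rewrite finset.inE => /asboolP et1.
move=> /andP[/vertex_class_lift[[a2 b2] e2]]; rewrite finset.inE => /asboolP et2.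
move=> c12 d1 d2.
have [s1 cv1] := @lifted_convex (c1.1, a1, b1) et1.
have [s2 cv2] := @lifted_convex (c2.1, a2, b2) et2.
(* Two different corners at one point cannot belong to the same lifted tile, whose vertices are
   distinct. *)
have kl : (c1.1, a1, b1) <> (c2.1, a2, b2).
  case=> t12 a12 b12; case/eqP: c12; case: c1 c2 t12 e1 e2 {et1 et2 d1 d2 cv1 cv2} => [t1 i1] [t2 i2] /= t12.
  rewrite /= -t12 -a12 -b12 => e1 e2; congr pair.
  by apply: (lifted_simple D (t1, a1, b1)).1; rewrite e1 e2.
apply: (corner_cones_disjoint cv1 cv2 (i := c1.2) (j := c2.2) (d := d)).
- by rewrite e1 e2.
- by have := tiling_disjoint D kl.
- by rewrite /corner_cone lifted_left lifted_right.
- by rewrite /corner_cone lifted_left lifted_right.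
Qed.

Lemma tile_at_vertex c k : tiles_at D (corner_point c) k ->
  exists i, lifted_tile D k i = corner_point c.
Proof.
rewrite /tiles_at /=; have <- : lifted_tile D (c.1, 0, 0) c.2 = corner_point c.
  by rewrite lifted_tileE /lattice_vector !mulr0z !addr0.
exact: vertex_of_region.
Qed.

Lemma weight_covering c : vertex_class c \subset efficient_corners ->
  2 * pi <= \sum_(c' in vertex_class c) weight c'.
Proof.
move=> /fintype.subsetP sub; apply: covering_angles => [c' /sub|d d0].
  by rewrite finset.inE => /asboolP /tile_convex[s]; exact: corner_cross_neq0.
have [e [e0 he]] : exists e : R, 0 < e /\ forall k,
    region (lifted_tile D k) (corner_point c + e *: d) -> region (lifted_tile D k) (corner_point c).
  have pos : \forall e \near 0^'+, (0 : R) < e by exact: nbhs_right_gt.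
  by have [e [h1 h2]] := filter_ex (filterI pos (near_region D (corner_point c) d)); exists e.
have [k rk] := tiling_cover D (corner_point c + e *: d).
have [i ki] := tile_at_vertex (he k rk).
have kc := lift_vertex_class ki.
exists (k.1.1, i) => //=.
have := sub _ kc; rewrite finset.inE => /asboolP /lifted_convex[s cv].
have := region_corner_closed_cone (i := i) cv e0 (d := d); rewrite ki => /(_ rk).
by rewrite /corner_closed_cone lifted_left lifted_right.
Qed.

Lemma card_efficient_at_vertex c : (#|vertex_class c :&: efficient_corners| <= 4)%N.
Proof.
set A := _ :&: _; have pi0 := pi_gt0 R.
have [A0|A0] := eqVneq #|A| 0%N; first by rewrite A0.
have lt : #|A|%:R * (2 * pi / 5) < 2 * pi :> R.
  apply: lt_le_trans (weight_packing c).
  rewrite mulr_natl -sumr_const; apply: ltr_sum => [|c'].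
    by move: A0; rewrite -lt0n => /card_gt0P[c' c'A]; apply/hasP; exists c'; rewrite ?mem_index_enum.
  by rewrite finset.in_setI => /andP[_]; exact: weight_gt.
have : #|A|%:R < 5%:R :> R.
  by rewrite -(ltr_pM2r (x := 2 * pi / 5)) ?divr_gt0 ?mulr_gt0 //; apply: lt_le_trans lt _; lra.
by rewrite ltr_nat.
Qed.

(** Sending a corner of the class to its lift at the point is a bijection onto the tiles there:
    surjective because edge-to-edge gives every such tile a corner at the point, injective because a
    tile has distinct vertices. *)
Lemma has_degree_class c : has_degree D (corner_point c) #|vertex_class c|.
Proof.
set A := vertex_class c.
have [phi hphi] : {phi : T * 'I_5 -> int * int & forall c', c' \in A ->
    lifted_tile D (c'.1, (phi c').1, (phi c').2) c'.2 = corner_point c}.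
  apply: (@choice _ _ (fun c' ab => c' \in A -> lifted_tile D (c'.1, ab.1, ab.2) c'.2 = corner_point c)).
  move=> c'; case: (boolP (c' \in A)) => [/vertex_class_lift[ab h]|_]; last by exists (0, 0).
  by exists ab.
pose f (n : nat) : T * int * int := let c' := nth c (enum A) n in (c'.1, (phi c').1, (phi c').2).
have nthA n : (n < #|A|)%N -> nth c (enum A) n \in A by move=> h; rewrite -mem_enum mem_nth // -cardE.
rewrite /has_degree (_ : tiles_at _ _ = f @` `I_#|A|); last first.
  apply/seteqP; split => k.
    move=> rk; have [i ki] := tile_at_vertex rk.
    have kA := lift_vertex_class ki.
    exists (index (k.1.1, i) (enum A)); first by rewrite /= cardE index_mem mem_enum.
    rewrite /f nth_index ?mem_enum //=; have := hphi _ kA.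
    rewrite -ki !lifted_tileE /= => /addrI /lattice_vector_inj [].
    by case: k {rk ki kA} => [[t a] b] /= -> ->.
  move=> [n /= nA <-]; have := hphi _ (nthA n nA).
  rewrite /tiles_at /f /=; move: (nth c _ n) => c' <-.
  by left; exists c'.2 => //; exact: segment_left.
apply: inj_card_eq => n m; rewrite !inE /= => nA mA [t1 a1 b1].
have e1 := hphi _ (nthA n nA); have e2 := hphi _ (nthA m mA).
have cc : nth c (enum A) n = nth c (enum A) m.
  move: t1 a1 b1 e1 e2; move: (nth c _ n) (nth c _ m) => [t i] [t' i'] /= <- <- <- e1 e2.
  by congr pair; apply: (lifted_simple D (t, (phi (t, i)).1, (phi (t, i)).2)).1; rewrite e1 e2.
by apply/eqP; rewrite -(nth_uniq c _ _ (enum_uniq A)) ?cc // -cardE.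
Qed.
End Counting.

(** * Angular excess over 2 pi / 3 and double counting of corners *)

Section DegreeFour.
Variables (R : realType) (T : finType) (D : torus_tiling R T) (E : polygon5 R).
Hypotheses (hE : efficient E) (hedge : edge_to_edge D).
Implicit Types c : T * 'I_5.

Local Notation EC := (efficient_corners D E).
Local Notation cls := (vertex_class D).

Lemma sum_corners (F : T * 'I_5 -> R) :
  \sum_(c in EC) F c = \sum_(t in copies D E) \sum_i F (t, i).
Proof.
rewrite pair_big_dep /=; apply: eq_big => [[t i]|[t i] _] //=.
by rewrite !finset.inE andbT.
Qed.

Lemma card_corners : #|EC| = (#|copies D E| * 5)%N.
Proof.
have -> : EC = finset.setX (copies D E) [set: 'I_5]%SET.
  by apply/setP => -[t i]; rewrite !finset.inE /= andbT.
by rewrite cardsX cardsT card_ord.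
Qed.

Hypothesis no_degree4 : forall c, cls c \subset EC -> #|cls c| != 4%N.

Lemma efficient_vertices_excess :
  0 <= \sum_(c in EC | cls c \subset EC) (weight D c - 2 * pi / 3).
Proof.
rewrite (partition_big cls predT) //=; apply: sumr_ge0 => B _.
case: (pickP (fun c => [&& c \in EC, cls c \subset EC & cls c == B])) => [c0|none]; last first.
  by rewrite big_pred0 // => c; rewrite -andbA none.
move=> /and3P[c0E c0S /eqP c0B].
rewrite (eq_bigl (fun c => c \in cls c0)) => [|c]; last first.
  apply/idP/idP => [/andP[_ /eqP cB]|cc0].
    by rewrite c0B -cB vertex_class_refl.
  by rewrite (vertex_class_eq cc0) c0S c0B eqxx (fintype.subsetP c0S).
rewrite sumrB sumr_const subr_ge0; apply: le_trans _ (weight_covering hE hedge c0S).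
have card3 : (#|cls c0| <= 3)%N.
  have := card_efficient_at_vertex D hE c0; rewrite (finset.setIidPl c0S) leq_eqVlt.
  by rewrite (negbTE (no_degree4 c0S)).
have pi0 := pi_gt0 R; rewrite -(mulr_natr (2 * pi / 3)).
apply: (@le_trans _ _ (2 * pi / 3 * 3%:R)); last by lra.
by rewrite ler_wpM2l ?ler_nat //; lra.
Qed.

(** Double counting: each corner on the left shares its vertex with some corner outside [EC], and
    the vertex of the latter carries at most four efficient corners. *)
Lemma card_other_corners :
  (#|[set c in EC | ~~ (cls c \subset EC)]%SET| <= #|~: EC| * 4)%N.
Proof.
rewrite -sum1_card -sum_nat_const.
apply: (@leq_trans (\sum_(c in [set c in EC | ~~ (cls c \subset EC)]%SET)
    \sum_(c' in ~: EC) (c' \in cls c))).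
  apply: leq_sum => c; rewrite finset.inE => /andP[_ /subsetPn[c' cc' c'E]].
  by rewrite (bigD1 c') /= ?cc' ?finset.in_setC.
rewrite exchange_big /=; apply: leq_sum => c' c'E.
apply: leq_trans (card_efficient_at_vertex D hE c').
rewrite -sum1_card [leqLHS]big_mkcond [leqRHS]big_mkcond; apply: leq_sum => c _.
rewrite finset.in_setI [c \in [set _ in _ | _]%SET]finset.inE; case: ifP => // /andP[cE _].
case: (boolP (c' \in cls c)) => // /vertex_class_eq cls_eq.
by rewrite cls_eq vertex_class_refl cE.
Qed.

End DegreeFour.

Theorem proposition4p3 (R : realType) (T : finType) (D : torus_tiling R T)
    (E N : polygon5 R)
    (hE : efficient E)
    (hN : type2_nonconvex N) (hN1 : area N = 1%:E)
    (htiles : forall t : T, congruent E (tile D t) \/ congruent N (tile D t))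
    (hdihedral : (0 < #|copies D E|)%N /\ (0 < #|copies D N|)%N)
    (hedge : edge_to_edge D)
    (hratio : 24 < #|copies D E|%:R / #|copies D N|%:R :> R) :
  exists x : R * R,
    [/\ is_vertex D x,
        forall k : T * int * int,
          tiles_at D x k -> congruent E (tile D k.1.1)
      & has_degree D x 4%N].
Proof.
apply: contrapT => hnone.
have no4 c : vertex_class D c \subset efficient_corners D E -> #|vertex_class D c| != 4%N.
  move=> cS; apply/eqP => c4; apply: hnone; exists (corner_point D c); split.
  - by exists (c.1, 0, 0), c.2; rewrite lifted_tileE /lattice_vector !mulr0z !addr0.
  - move=> k rk; have [i ki] := tile_at_vertex hedge rk.
    have := fintype.subsetP cS _ (lift_vertex_class ki).
    by rewrite finset.inE => /asboolP.
  - by rewrite -c4; exact: has_degree_class.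
set EC := efficient_corners D E.
pose nE := #|copies D E|; pose nN := #|copies D N|.
have pi0 := pi_gt0 R.
(* Every tile is a copy of [E] or of [N], so the tiles that are not copies of [E] number at most
   [nN], with five corners each. *)
have others : (#|~: EC| <= nN * 5)%N.
  have cE := cardsC EC; rewrite card_prod card_ord card_corners in cE.
  have sub : (#|T| <= nE + nN)%N.
    rewrite -cardsT; apply: leq_trans (leq_card_setU _ _).
    apply: subset_leq_card; apply/fintype.subsetP => t _; rewrite !finset.inE.
    by case: (htiles t) => h; apply/orP; [left | right]; apply/asboolP.
  by rewrite -(leq_add2l (nE * 5)) -mulnDl cE leq_mul2r sub orbT.
(* Each efficient tile contributes 3 pi - 5 (2 pi / 3) = - pi / 3. *)
have total : \sum_(c in EC) (weight D c - 2 * pi / 3) = - (nE%:R * pi / 3).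
  rewrite sum_corners (eq_bigr (fun=> - (pi / 3))) => [|t]; last first.
    rewrite finset.inE => /asboolP /(sum_weight hE) st.
    by rewrite sumrB st sumr_const card_ord; field.
  by rewrite sumr_const -/nE -mulr_natl; field.
have excess := efficient_vertices_excess hE hedge no4.
(* 4 pi / 15 is 2 pi / 3 - 2 pi / 5, and 20 is five corners per tile times four efficient corners
   per vertex. *)
have rest : - (4 * pi / 15 * (nN * 20)%:R) <=
    \sum_(c in EC | ~~ (vertex_class D c \subset EC)) (weight D c - 2 * pi / 3).
  apply: (@le_trans _ _ (\sum_(c in [set c in EC | ~~ (vertex_class D c \subset EC)]%SET) - (4 * pi / 15))).
    rewrite sumr_const mulNrn lerN2 -(mulr_natr (4 * pi / 15)) ler_wpM2l ?ler_nat //; first by lra.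
    apply: leq_trans (card_other_corners D hE) _.
    by rewrite (_ : nN * 20 = nN * 5 * 4)%N ?leq_mul2r ?others // -mulnA.
  rewrite big_set; apply: ler_sum => c /andP[cE _].
  by have := weight_gt hE cE; lra.
have nN0 : 0 < nN%:R :> R by rewrite ltr0n; case: hdihedral.
move: hratio; rewrite ltr_pdivlMr // -/nE -/nN => lt24.
have := total; rewrite (bigID (fun c => vertex_class D c \subset EC)) /=.
rewrite natrM in rest; move: nE nN {others total} nN0 lt24 rest excess => nE nN nN0 lt24 rest excess tot.
(* The products with [pi] are formed here so that the final comparison is linear in [pi * nE] and
   [pi * nN]. *)
have h1 : pi * (24 * nN%:R) < pi * nE%:R :> R by rewrite ltr_pM2l.
have h2 : 0 < pi * nN%:R :> R by rewrite mulr_gt0.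
move: tot rest excess; move: (\sum_(c in _ | _) _) (\sum_(c in _ | _) _) => a b tot rest excess.
by clear -tot rest excess h1 h2; lra.
Qed.
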